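(* Every double spider is strongly antimagic.
   Context: All graphs are finite and simple. For a graph $G=(V,E)$ and a bijection $f:E\to\{1,2,\dots,|E|\}$, the vertex sum at $u$ is $\varphi_f(u)=\sum_{e\in E(u)}f(e)$, where $E(u)$ is the set of edges incident to $u$. The labeling $f$ is strongly antimagic if $\varphi_f(u)\neq\varphi_f(v)$ for all distinct $u,v\in V$ and moreover $\deg(u)<\deg(v)$ implies $\varphi_f(u)<\varphi_f(v)$. A graph is strongly antimagic if it admits a strongly antimagic labeling. A double spider is a tree containing exactly two vertices of degree at least $3$. *)

(* Defs.v *)
From mathcomp Require Import all_boot.
Set Implicit Arguments. Unset Strict Implicit. Unset Printing Implicit Defensive.

Definition simple_graph (T : finType) (e : rel T) : Prop :=
  symmetric e /\ irreflexive e.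

Definition edges (T : finType) (e : rel T) : {set {set T}} :=
  [set A : {set T} | [exists x, exists y, e x y && (A == [set x; y])]].

Definition deg (T : finType) (e : rel T) (x : T) : nat := #|[set y | e x y]|.

Definition is_tree (T : finType) (e : rel T) : Prop :=
  0 < #|T| /\ (forall x y : T, connect e x y) /\ #|edges e| + 1 = #|T|.

Definition double_spider (T : finType) (e : rel T) : Prop :=
  is_tree e /\ #|[set x | 3 <= deg e x]| = 2.

(* f restricted to the edge set is a bijection onto {1, ..., |E|}. *)
Definition edge_labeling (T : finType) (e : rel T) (f : {set T} -> nat) : Prop :=
  {in edges e &, injective f} /\
  (forall A, A \in edges e -> 1 <= f A <= #|edges e|).

Definition vsum (T : finType) (e : rel T) (f : {set T} -> nat) (u : T) : nat :=
  \sum_(y | e u y) f [set u; y].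

Definition strongly_antimagic_labeling (T : finType) (e : rel T) (f : {set T} -> nat) : Prop :=
  edge_labeling e f /\
  (forall u v : T, u != v -> vsum e f u != vsum e f v) /\
  (forall u v : T, deg e u < deg e v -> vsum e f u < vsum e f v).

Definition strongly_antimagic (T : finType) (e : rel T) : Prop :=
  exists f : {set T} -> nat, strongly_antimagic_labeling e f.

(* Main.v *)
Require Import Defs.
From mathcomp Require Import all_boot.
From mathcomp Require Import zify.
Set Implicit Arguments. Unset Strict Implicit. Unset Printing Implicit Defensive.

(* Call u, v the hubs, deg v <= deg u. We look for a labelling in which the leaf labels are at
   most M, the sums at the vertices of degree two are distinct and exceed M, and all of them
   are smaller than the sum at v, which is smaller than the sum at u. Such labellings are
   built by induction on the legs. Inserting a new block of small and a new block of medium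
   labels, and shifting the old labels, makes room for a new leg labelled in a zigzag, so that
   its sums are consecutive integers below or between the old ones: this adds a leg at u, an
   odd leg at v, or a leg at u of length one together with an even leg at v. If all legs have
   length at least two, remove the last edge of each, label the rest, shift it, and give the
   removed edges the smallest labels in the order of the edges next to them. What remains are
   the double spiders with both hubs of degree three and a leg of length one; there the
   lengths only matter up to replacing an edge by a zigzag of odd length, and finitely many
   families of labellings, with the zigzag lengths as parameters, cover all cases. Their
   inequalities are between affine forms and are checked coefficientwise. *)

(** An even zigzag with a small leaf label has a label above the threshold at its hub, which at v
    could push the sum past that of u; an odd one can have 1 there. This is why an even leg of v
    comes together with a leg of u, whose single label compensates. The operations consume and
    produce different invariants, so three of increasing strength are kept. [good2] suffices for the
    theorem. Inserting a zigzag requires [goodZ]: every vertex of degree two has a label above the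
    threshold, so that the shift lifts all old sums over the new ones. An even leg of length at
    least four at v requires [good3], whose two further thresholds leave gaps for the last two sums
    of that leg. Lengthening all legs by one edge turns [good2] into [goodZ] and [goodZ] into
    [good3], whereas adding a leg of length two at v yields only [good2]. Hence the induction, on
    the total length of the legs, proves [good2] for all shapes and [goodZ] for the shapes outside
    [exc]. *)

(** * Adjacent pairs and zigzags *)

Definition adjs (s : seq nat) : seq (nat * nat) := zip s (behead s).
Definition psum (d : nat * nat) : nat := d.1 + d.2.
Definition both (f : nat -> nat) (d : nat * nat) : nat * nat := (f d.1, f d.2).
Definition swap (d : nat * nat) : nat * nat := (d.2, d.1).

Lemma adjs_cat x s y t :
  adjs ((x :: s) ++ y :: t) = adjs (x :: s) ++ (last x s, y) :: adjs (y :: t).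
Proof. by elim: s x => [|z s IHs] x //=; congr cons; apply: IHs. Qed.

Lemma adjs_rcons x s y : adjs (rcons (x :: s) y) = rcons (adjs (x :: s)) (last x s, y).
Proof. by rewrite -cats1 adjs_cat cats1. Qed.

Lemma adjs_map f s : adjs (map f s) = map (both f) (adjs s).
Proof.
elim: s => [|x [|y s] IHs] //=; congr cons; exact: IHs.
Qed.

Lemma adjs_rev s : adjs (rev s) = rev (map swap (adjs s)).
Proof.
elim: s => [|x [|y s] IHs] //; rewrite rev_cons.
have -> : adjs (x :: y :: s) = (x, y) :: adjs (y :: s) by [].
rewrite [in RHS]map_cons [in RHS]rev_cons -IHs.
case E: (rev (y :: s)) => [|z r]; first by move/(congr1 size): E; rewrite size_rev.
rewrite adjs_rcons; congr (rcons _ (_, _)).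
by have := congr1 (last 0) E; rewrite /= rev_cons last_rcons.
Qed.

Lemma psum_swap d : psum (swap d) = psum d.
Proof. exact: addnC. Qed.

Lemma adjs_rev_sums s : map psum (adjs (rev s)) = rev (map psum (adjs s)).
Proof.
by rewrite adjs_rev map_rev -map_comp; congr rev; apply: eq_map => d /=; apply: psum_swap.
Qed.

Lemma mem_adjs_rev s (d : nat * nat) : d \in adjs (rev s) -> swap d \in adjs s.
Proof. by rewrite adjs_rev mem_rev => /mapP[e es ->]; case: e es. Qed.

Fixpoint zig n a b : seq nat := if n is n'.+1 then a :: zig n' b a.+1 else [::].

Lemma size_zig n a b : size (zig n a b) = n.
Proof. by elim: n a b => //= n IHn a b; rewrite IHn. Qed.

Lemma mem_zig n a b (x : nat) : x \in zig n a b ->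
  (a <= x < a + uphalf n) || (b <= x < b + n./2).
Proof.
elim: n a b => //= n IHn a b; rewrite inE => /orP[/eqP->|/IHn]; last lia.
lia.
Qed.

Lemma zig_uniq n a b : (a + uphalf n <= b) || (b + n./2 <= a) -> uniq (zig n a b).
Proof.
elim: n a b => //= n IHn a b Hab; rewrite IHn; last lia.
by rewrite andbT; apply/negP => /mem_zig; lia.
Qed.

(** Passing from one pair to the next only replaces [a] by [a.+1], or [b] by [b.+1]. So the inner
    sums of a zigzag fill an interval, and only its two ends have to be compared with other sums. *)
Lemma zig_sums n a b : map psum (adjs (zig n a b)) = iota (a + b) n.-1.
Proof.
elim: n a b => // -[//|n] IHn a b.
have -> : adjs (zig n.+2 a b) = (a, b) :: adjs (zig n.+1 b a.+1) by [].
by rewrite map_cons IHn /= addnS [b + a]addnC.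
Qed.

Lemma mem_adjs_zig n a b (d : nat * nat) : d \in adjs (zig n a b) ->
  ((a <= d.1 < a + uphalf n) && (b <= d.2 < b + n./2)) ||
  ((a <= d.2 < a + uphalf n) && (b <= d.1 < b + n./2)).
Proof.
elim: n a b => // -[//|n] IHn a b.
have -> : adjs (zig n.+2 a b) = (a, b) :: adjs (zig n.+1 b a.+1) by [].
rewrite inE => /orP[/eqP->|/IHn] /=; lia.
Qed.

Lemma last_zig n a b : last a (zig n b a.+1) = if odd n then b + n./2 else a + n./2.
Proof.
by elim: n a b => [|n IHn] a b /=; rewrite ?addn0 // IHn; case E: (odd n) => /=; lia.
Qed.

Lemma last_rev (s : seq nat) x : last x (rev s) = head x s.
Proof. by case: s => //= y s; rewrite rev_cons last_rcons. Qed.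

Lemma head_rev (s : seq nat) x : head x (rev s) = last x s.
Proof. by rewrite -last_rev revK. Qed.

(** * Label data of a tree *)

(* All labels, the label pairs at the vertices of degree two, the labels at the leaves, and
   the labels around the two hubs [u] and [v]. *)
Record cfg := Cfg {
  cL : seq nat;
  cD : seq (nat * nat);
  cE : seq nat;
  cU : seq nat;
  cV : seq nat }.

(** When the labels above [t] move up by [j], the sum at a vertex of degree two grows by [j] times
    this number. *)
Definition cls (t : nat) (d : nat * nat) : nat := (t < d.1) + (t < d.2).

(* Besides antimagicness, the conditions [g_cls] and [g_kap] ensure that the strict
   inequalities survive when all labels, or all labels above [M], are shifted. *)
Record good2 (M : nat) (c : cfg) : Prop := Good2 {
  g_uniq : uniq (cL c);
  g_bnd : forall x : nat, x \in cL c -> 0 < x <= size (cL c);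
  g_size : M <= size (cL c);
  g_pos : forall d : nat * nat, d \in cD c -> (0 < d.1) && (0 < d.2);
  g_sums : uniq (map psum (cD c));
  g_leaf : forall x : nat, x \in cE c -> x <= M;
  g_low : forall d : nat * nat, d \in cD c -> M < psum d;
  g_cls : forall d d' : nat * nat, d \in cD c -> d' \in cD c -> cls M d < cls M d' -> psum d < psum d';
  g_V : forall d : nat * nat, d \in cD c -> psum d < sumn (cV c);
  g_MV : M < sumn (cV c);
  g_UV : sumn (cV c) < sumn (cU c);
  g_kap : count (ltn M) (cV c) <= (count (ltn M) (cU c)).+1 }.

(** The additional conditions ensure that a shift by [j] of the labels above [s] raises every sum of
    degree two, and the sum at v, by at least [j]. *)
Record goodZ (s : nat) (c : cfg) : Prop := GoodZ {
  z_good2 : good2 s c;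
  z_cls : forall d : nat * nat, d \in cD c -> 0 < cls s d;
  z_V : 0 < count (ltn s) (cV c) }.

Definition cext (f : nat -> nat) (l : seq nat) (d : seq (nat * nat)) (e u v : seq nat)
  (c : cfg) : cfg :=
  Cfg (l ++ map f (cL c)) (d ++ map (both f) (cD c)) (e ++ map f (cE c))
      (u ++ map f (cU c)) (v ++ map f (cV c)).

Lemma uniq_cat_map (f : nat -> nat) (l L : seq nat) : uniq l -> uniq L ->
  {homo f : x y / x < y} -> (forall x y : nat, x \in l -> y \in L -> x != f y) ->
  uniq (l ++ map f L).
Proof.
move=> ul uL fm dis; rewrite cat_uniq ul map_inj_uniq ?uL ?andbT.
  by apply/hasPn => _ /mapP[y yL ->]; apply/negP => /dis/(_ yL); rewrite eqxx.
by move=> x y Exy; have := fm x y; have := fm y x; rewrite Exy !ltnn; lia.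
Qed.

Lemma uniq_sums_cat_map (f : nat -> nat) (d D : seq (nat * nat)) : uniq (map psum d) -> uniq (map psum D) ->
  (forall p q : nat * nat, p \in D -> q \in D -> psum p < psum q -> psum (both f p) < psum (both f q)) ->
  (forall p q : nat * nat, p \in d -> q \in D -> psum p != psum (both f q)) ->
  uniq (map psum (d ++ map (both f) D)).
Proof.
move=> ud uD fm dis; rewrite map_cat cat_uniq ud -map_comp /=.
apply/andP; split.
  apply/hasPn => _ /mapP[q qD ->]; apply/negP => /mapP[p pd] /= Epq.
  by have := dis p q pd qD; rewrite Epq eqxx.
rewrite map_inj_in_uniq ?(map_uniq uD) // => p q pD qD /= Epq.
have Hs : psum p = psum q.
  by have := fm p q pD qD; have := fm q p qD pD; rewrite Epq !ltnn; lia.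
apply/eqP; rewrite -(nth_index p pD) -(nth_index p qD).
have Hn (r : nat * nat) : r \in D -> nth 0 (map psum D) (index r D) = psum r.
  by move=> rD; rewrite (nth_map p) ?index_mem // nth_index.
apply/eqP; congr nth; apply/eqP.
by rewrite -(nth_uniq 0 _ _ uD) ?size_map ?index_mem // !Hn // Hs.
Qed.

(** Leaves room for [k] labels at the bottom and for [j] labels just above the old label [s]. *)
Definition sh (k s j x : nat) : nat := x + k + (if s < x then j else 0).

Lemma sh_homo k s j : {homo sh k s j : x y / x < y}.
Proof. by move=> x y; rewrite /sh; do 2 case: ifP; lia. Qed.

Lemma sumn_sh k s j l : sumn (map (sh k s j) l) = sumn l + k * size l + j * count (ltn s) l.
Proof.
elim: l => [|x l IHl] /=; first by rewrite !muln0.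
by rewrite IHl /sh mulnS; case: (s < x) => /=; rewrite ?mulnDr; lia.
Qed.

Lemma count_sh k s j l : count (ltn (s + k)) (map (sh k s j) l) = count (ltn s) l.
Proof.
rewrite count_map; apply: eq_count => x /=; rewrite /sh.
by case: ifP; lia.
Qed.

Lemma cls_sh k s j d : cls (s + k) (both (sh k s j) d) = cls s d.
Proof. by rewrite /cls /both /sh /=; do 2 case: ifP; lia. Qed.

Lemma psum_sh k s j d : psum (both (sh k s j) d) = psum d + 2 * k + j * cls s d.
Proof. by rewrite /psum /both /sh /cls /=; do 2 case: ifP => _; rewrite ?muln0 ?muln1 ?muln2; lia. Qed.

(** * Adding legs to a labelled tree *)

(** The leg takes the labels from 1 to [k] and from [s + k + 1] to [s + n], and its sums run from
    [s + k + 2] to [s + k + n]. An old pair has a label above [s], hence a sum of at least [s + 2],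
    which becomes at least [s + k + n + 2]; so the new sums lie below the old ones. The last two
    hypotheses preserve [g_kap] and say that v gains no more than u. *)
Lemma goodZ_insert n s c (leg u v : seq nat) (k := uphalf n) (j := n./2) (f := sh k s j) :
  goodZ s c -> 3 <= size (cV c) ->
  leg = zig n 1 (s + k).+1 \/ leg = rev (zig n 1 (s + k).+1) ->
  {subset u <= leg} -> {subset v <= leg} -> 0 < n -> last 0 leg <= k ->
  count (ltn (s + k)) v + count (ltn s) (cV c) <=
    (count (ltn (s + k)) u + count (ltn s) (cU c)).+1 ->
  sumn v + k * size (cV c) + j * count (ltn s) (cV c) <=
    sumn u + k * size (cU c) + j * count (ltn s) (cU c) ->
  goodZ (s + k) (cext f leg (adjs leg) [:: last 0 leg] u v c).
Proof.
move=> [G Zc ZV] s3 legE uleg vleg n0 leaf kap UV.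
have kE : k = uphalf n by [].
have jE : j = n./2 by [].
clearbody k j.
have Ekj : k + j = n by lia.
have szleg : size leg = n by case: legE => ->; rewrite ?size_rev size_zig.
have memleg (x : nat) : x \in leg -> (0 < x <= k) || (s + k < x <= s + n).
  by case: legE => ->; rewrite ?mem_rev => /mem_zig; rewrite -kE -jE; lia.
have memd (d : nat * nat) : d \in adjs leg -> ((0 < d.1 <= k) && (s + k < d.2)) || ((0 < d.2 <= k) && (s + k < d.1)).
  case: legE => ->; first by move/mem_adjs_zig; rewrite -kE -jE; lia.
  by move/mem_adjs_rev/mem_adjs_zig => /=; rewrite -kE -jE; lia.
have sumsd : uniq (map psum (adjs leg)) /\
    (forall d : nat * nat, d \in adjs leg -> s + k + 2 <= psum d <= s + k + n).
  have Hs : perm_eq (map psum (adjs leg)) (iota (s + k + 2) n.-1).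
    have E0 : 1 + (s + k).+1 = s + k + 2 by lia.
    by case: legE => ->; rewrite ?adjs_rev_sums ?perm_rev zig_sums E0.
  split; first by rewrite (perm_uniq Hs) iota_uniq.
  by move=> d /(map_f psum); rewrite (perm_mem Hs) mem_iota; lia.
have clsd (d : nat * nat) : d \in adjs leg -> cls (s + k) d = 1.
  by move/memd; rewrite /cls; lia.
have Dlow (d : nat * nat) : d \in cD c -> s + 2 <= psum d.
  by move=> dD; have := Zc _ dD; have := g_pos G dD; rewrite /cls /psum; lia.
have Vgt : s < sumn (cV c) := g_MV G.
have VE : sumn (v ++ map f (cV c)) =
    sumn v + sumn (cV c) + k * size (cV c) + j * count (ltn s) (cV c).
  by rewrite sumn_cat sumn_sh; lia.
have UE : sumn (u ++ map f (cU c)) =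
    sumn u + sumn (cU c) + k * size (cU c) + j * count (ltn s) (cU c).
  by rewrite sumn_cat sumn_sh; lia.
have kV : 3 * k <= k * size (cV c) by rewrite mulnC leq_mul2l s3 orbT.
have jV : j <= j * count (ltn s) (cV c) by rewrite leq_pmulr.
have szL : size (leg ++ map f (cL c)) = n + size (cL c) by rewrite size_cat size_map szleg.
have mono (d d' : nat * nat) : d \in cD c -> d' \in cD c -> psum d < psum d' ->
    psum (both f d) < psum (both f d').
  move=> dD dD' ltd; rewrite !psum_sh.
  (* By contraposition [g_cls] shows that the pair with the larger sum has at least as many labels
     above [s], so it gains at least as much. *)
  have := @g_cls _ _ G d' d dD' dD; have := leq_mul2l j (cls s d) (cls s d'); lia.
split; last 2 first.
- move=> d /=; rewrite mem_cat => /orP[/clsd-> //|/mapP[e eD ->]].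
  by rewrite cls_sh; apply: Zc.
- by rewrite /= count_cat count_sh; lia.
split.
- apply: uniq_cat_map (g_uniq G) _ _.
  + by case: legE => ->; rewrite ?rev_uniq; apply: zig_uniq; rewrite -kE; lia.
  + exact: sh_homo.
  + move=> x y /memleg Hx /(g_bnd G) Hy; apply/eqP; rewrite /f /sh; case: ifP; lia.
- move=> x; rewrite szL /= mem_cat => /orP[/memleg|/mapP[y /(g_bnd G) Hy ->]].
    by have := g_size G; lia.
  by rewrite /f /sh; case: ifP; lia.
- by rewrite szL; have := g_size G; lia.
- move=> d /=; rewrite mem_cat => /orP[/memd|/mapP[e /(g_pos G) He ->]]; first lia.
  by rewrite /both /f /sh /=; lia.
- apply: uniq_sums_cat_map => //; [by case: sumsd | exact: g_sums G|].
  move=> p q /(proj2 sumsd) Hp qD; rewrite psum_sh.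
  by have := Dlow _ qD; have := leq_pmulr j (Zc _ qD); lia.
- move=> x /=; rewrite inE => /orP[/eqP->|/mapP[y /(g_leaf G) Hy ->]]; first lia.
  by rewrite /f /sh; case: ifP; lia.
- move=> d /=; rewrite mem_cat => /orP[/(proj2 sumsd)|/mapP[e eD ->]]; first lia.
  by rewrite psum_sh; have := Dlow _ eD; lia.
- move=> d d' /=; rewrite !mem_cat => /orP[Hd|/mapP[e eD ->]] /orP[Hd'|/mapP[e' eD' ->]].
  + by rewrite !clsd.
  + rewrite psum_sh => _; have := proj2 sumsd _ Hd; have := Dlow _ eD'.
    by have := leq_pmulr j (Zc _ eD'); lia.
  + by rewrite (clsd d') // cls_sh; have := Zc _ eD; lia.
  + by rewrite !cls_sh => Hc; apply: mono => //; apply: (g_cls G).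
- move=> d; rewrite VE /= mem_cat => /orP[/(proj2 sumsd)|/mapP[e eD ->]]; first lia.
  (* The old pair gains at most [2 * k + 2 * j] and v at least [3 * k + j], where [j <= k]. *)
  rewrite psum_sh; have := g_V G eD.
  have : j * cls s e <= 2 * j by rewrite mulnC leq_mul2r /cls; lia.
  lia.
- by rewrite /= VE; lia.
- by rewrite /= VE UE; have := g_UV G; lia.
- by rewrite /= !count_cat !count_sh; lia.
Qed.

(** The reversed zigzag has 1 at the leaf and a label of at least [k] at u. This outweighs the extra
    [j] that v may gain, since [g_kap] allows it one more label above [s] than u. *)
Lemma goodZ_add_u n s c (k := uphalf n) (leg := rev (zig n 1 (s + k).+1)) :
  goodZ s c -> 3 <= size (cV c) <= size (cU c) -> 0 < n ->
  goodZ (s + k) (cext (sh k s n./2) leg (adjs leg) [:: last 0 leg] [:: head 0 leg] [::] c).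
Proof.
move=> G /andP[s3 sUV] n0.
have hE : head 0 leg = if odd n then k else s + n.
  rewrite /leg head_rev; case: n n0 @k @leg => //= n _.
  by rewrite last_zig; case E: (odd n) => /=; lia.
apply: goodZ_insert => //; first by right.
- move=> x; rewrite inE => /eqP->; rewrite mem_rev head_rev.
  by case: n n0 @k @leg {hE} => //= n _; apply: mem_last.
- by rewrite last_rev; case: n n0 @k @leg {hE} => //= n _; lia.
- by have := g_kap (z_good2 G) => /=; lia.
- have kap := g_kap (z_good2 G).
  rewrite /= hE add0n addn0.
  have kk : k * size (cV c) <= k * size (cU c) by rewrite leq_mul2l sUV orbT.
  have jj : n./2 * count (ltn s) (cV c) <= n./2 * count (ltn s) (cU c) + n./2.
    by rewrite -mulnSr leq_mul2l kap orbT.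
  by case: ifP => _; rewrite -/k; lia.
Qed.

(** For odd [n] both ends of the zigzag are small and v receives 1. With [g_kap], v is ahead by at
    most [1 + j = k] from this label and the shift by [j]; the additional old edge at u makes up for
    exactly that, hence the strict inequality between the degrees. *)
Lemma goodZ_add_v n s c (k := uphalf n) (leg := zig n 1 (s + k).+1) :
  goodZ s c -> 3 <= size (cV c) < size (cU c) -> odd n ->
  goodZ (s + k) (cext (sh k s n./2) leg (adjs leg) [:: last 0 leg] [::] [:: head 0 leg] c).
Proof.
move=> G /andP[s3 sUV] no.
have n0 : 0 < n by case: n no @k @leg.
have hE : head 0 leg = 1 by rewrite /leg; case: n n0 {no} @k @leg.
apply: goodZ_insert => //; first by left.
- by move=> x; rewrite inE hE => /eqP->; rewrite /leg; case: n n0 {no} @k @leg hE => //= n _ _; rewrite inE.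
- rewrite /leg; case: n n0 no @k @leg {hE} => //= n _ no.
  by rewrite last_zig (negbTE no); lia.
- by rewrite hE /=; have := g_kap (z_good2 G); lia.
- have kap := g_kap (z_good2 G).
  rewrite hE /= add0n addn0.
  have kk : k * size (cV c) + k <= k * size (cU c) by rewrite -mulnSr leq_mul2l sUV orbT.
  have jj : n./2 * count (ltn s) (cV c) <= n./2 * count (ltn s) (cU c) + n./2.
    by rewrite -mulnSr leq_mul2l kap orbT.
  by rewrite /k in kk *; lia.
Qed.

(** No vertex of degree two is created and nothing is inserted above [M], so this works from [good2]
    and applies to shapes without a [goodZ] labelling at hand. *)
Lemma good2_add_short c M : good2 M c -> 3 <= size (cV c) <= size (cU c) ->
  good2 M.+1 (cext (sh 1 M 0) [:: 1] [::] [:: 1] [:: 1] [::] c).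
Proof.
move=> G /andP[s3 sUV]; have E1 : M.+1 = M + 1 by rewrite addn1.
have shE (x : nat) : sh 1 M 0 x = x + 1 by rewrite /sh; case: ifP; rewrite addn0.
have mono (d d' : nat * nat) : psum d < psum d' ->
    psum (both (sh 1 M 0) d) < psum (both (sh 1 M 0) d').
  by rewrite !psum_sh; lia.
split => /=.
- apply: (@uniq_cat_map _ [:: 1] _ isT (g_uniq G)); first exact: sh_homo.
  by move=> x y; rewrite inE shE => /eqP-> /(g_bnd G); lia.
- move=> x; rewrite inE size_map => /orP[/eqP->|/mapP[y /(g_bnd G) Hy ->]] //.
  by rewrite shE; lia.
- by rewrite size_map; apply: g_size G.
- by move=> d /mapP[e /(g_pos G) He ->]; rewrite /= !shE; lia.
- by apply: (@uniq_sums_cat_map _ [::]) (g_sums G) _ _ => // p q _ _; apply: mono.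
- by move=> x; rewrite inE => /orP[/eqP->|/mapP[y /(g_leaf G) Hy ->]] //; rewrite shE; lia.
- by move=> d /mapP[e /(g_low G) He ->]; rewrite psum_sh; lia.
- move=> d d' /mapP[e eD ->] /mapP[e' eD' ->]; rewrite E1 !cls_sh => Hc.
  by apply: mono; apply: (g_cls G).
- by move=> d /mapP[e /(g_V G) He ->]; rewrite psum_sh sumn_sh; lia.
- by rewrite sumn_sh; have := g_MV G; lia.
- by rewrite !sumn_sh; have := g_UV G; lia.
- by rewrite E1 !count_sh; have := g_kap G; lia.
Qed.

(* The new leg of [v] carries 1 at the hub and the new largest leaf label at its end, so its
   inner vertex becomes the smallest vertex of degree two. *)
Lemma good2_add_pair c M : good2 M c -> 3 <= size (cV c) <= size (cU c) ->
  good2 (M + 3) (cext (sh 2 M 1) [:: 2; 1; M + 3] [:: (1, M + 3)] [:: 2; M + 3] [:: 2] [:: 1] c).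
Proof.
move=> G /andP[s3 sUV].
have clsE (d : nat * nat) : cls (M + 3) (both (sh 2 M 1) d) = cls M d.
  by rewrite /cls /both /sh /=; do 2 case: ifP; lia.
have cntE l : count (ltn (M + 3)) (map (sh 2 M 1) l) = count (ltn M) l.
  by rewrite count_map; apply: eq_count => x /=; rewrite /sh; case: ifP; lia.
have cls2 (d : nat * nat) : cls M d <= 2 by rewrite /cls; lia.
have cls0 : cls (M + 3) (1, M + 3) = 0 by rewrite /cls /=; lia.
have mono (d d' : nat * nat) : d \in cD c -> d' \in cD c -> psum d < psum d' ->
    psum (both (sh 2 M 1) d) < psum (both (sh 2 M 1) d').
  move=> dD dD' ltd; rewrite !psum_sh.
  by have := @g_cls _ _ G d' d dD' dD; lia.
split => /=.
- apply: (@uniq_cat_map _ [:: 2; 1; M + 3] _ _ (g_uniq G)) => [|x y|x y]; last 2 first.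
  + exact: sh_homo.
  + by rewrite !inE /sh => Hx /(g_bnd G); case: ifP; lia.
  + by rewrite /= !inE; lia.
- move=> x; rewrite !inE size_map !orbA; have := g_size G.
  move=> HM /orP[|/mapP[y /(g_bnd G) Hy ->]]; first lia.
  by rewrite /sh; case: ifP; lia.
- by rewrite size_map; have := g_size G; lia.
- move=> d; rewrite inE => /orP[/eqP-> /=|/mapP[e /(g_pos G) He ->]]; first lia.
  by rewrite /= /sh; lia.
- apply: (@uniq_sums_cat_map _ [:: (1, M + 3)]) (g_sums G) _ _ => //.
  by move=> p q; rewrite inE => /eqP-> /(g_low G); rewrite psum_sh /psum /=; lia.
- move=> x; rewrite !inE !orbA => /orP[|/mapP[y /(g_leaf G) Hy ->]]; first lia.
  by rewrite /sh; case: ifP; lia.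
- move=> d; rewrite inE => /orP[/eqP->|/mapP[e /(g_low G) He ->]]; first by rewrite /psum /=; lia.
  by rewrite psum_sh; lia.
- move=> d d'; rewrite !inE => /orP[/eqP->|/mapP[e eD ->]] /orP[/eqP->|/mapP[e' eD' ->]].
  + by rewrite ltnn.
  + by move=> _; rewrite psum_sh /psum /=; have := g_low G eD'; rewrite /psum; lia.
  + by rewrite cls0.
  + by rewrite !clsE => Hc; apply: mono => //; apply: (g_cls G).
- move=> d; rewrite sumn_sh inE => /orP[/eqP->|/mapP[e /(g_V G) He ->]].
    by have := g_MV G; rewrite /psum /=; lia.
  by rewrite psum_sh; have := cls2 e; lia.
- by rewrite sumn_sh; have := g_MV G; lia.
(* The new labels 2 at u and 1 at v make up exactly for the one extra label above [M] that [g_kap]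
   allows at v. *)
- by rewrite !sumn_sh; have := g_UV G; have := g_kap G; lia.
- by rewrite !cntE; have := g_kap G; lia.
Qed.

(** * Lengthening every leg by one edge *)

Definition rank (E : seq nat) x := (count (gtn x) E).+1.

Lemma rank_le E x : x \in E -> rank E x <= size E.
Proof.
move=> xE; rewrite /rank -(count_predC (gtn x) E) -addn1 leq_add2l -has_count.
by apply/hasP; exists x => //=; rewrite ltnn.
Qed.

Lemma rank_lt E x y : x \in E -> x < y -> rank E x < rank E y.
Proof.
move=> xE xy; rewrite /rank ltnS.
have -> : count (gtn y) E = count (gtn x) E + count (fun z => x <= z < y) E.
  by rewrite -count_predUI [X in _ = _ + X](eq_count (a2 := pred0)) ?count_pred0 ?addn0;
    [apply: eq_count | ]; move=> z /=; lia.
by rewrite -addn1 leq_add2l -has_count; apply/hasP; exists x => //; rewrite leqnn.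
Qed.

(** The name refers to the smaller tree: [c] labels what is left after the last edges are removed,
    and [cpeel c] labels the whole tree. *)
Definition cpeel (c : cfg) (w := size (cE c)) : cfg :=
  Cfg (map (addn w) (cL c) ++ map (rank (cE c)) (cE c))
      (map (both (addn w)) (cD c) ++ [seq (w + x, rank (cE c) x) | x <- cE c])
      (map (rank (cE c)) (cE c)) (map (addn w) (cU c)) (map (addn w) (cV c)).

Lemma sumn_add w l : sumn (map (addn w) l) = sumn l + w * size l.
Proof. by elim: l => [|x l IHl] /=; rewrite ?muln0 // IHl mulnS; lia. Qed.

Section Peel.
Variables (M : nat) (c : cfg).
Hypotheses (G : good2 M c) (s3 : 3 <= size (cV c) <= size (cU c)).
Hypotheses (uE : uniq (cE c)) (E0 : forall x : nat, x \in cE c -> 0 < x).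
Hypothesis U0 : forall x : nat, x \in cU c -> 0 < x.
Hypothesis V0 : forall x : nat, x \in cV c -> 0 < x.
Let w := size (cE c).
Let r := rank (cE c).

Lemma mem_cpeel (d : nat * nat) : d \in cD (cpeel c) ->
  (exists2 e : nat * nat, e \in cD c & d = (w + e.1, w + e.2)) \/
  (exists2 x : nat, x \in cE c & d = (w + x, r x)).
Proof.
by rewrite mem_cat => /orP[/mapP[e eD ->]|/mapP[x xE ->]]; [left; exists e | right; exists x].
Qed.

Lemma r_le (x : nat) : x \in cE c -> 0 < r x <= w.
Proof. by move=> xE; rewrite rank_le. Qed.

Lemma r_sum (x y : nat) : x \in cE c -> y \in cE c -> w + x + r x = w + y + r y -> x = y.
Proof.
move=> xE yE Exy; case: (ltngtP x y) => // lt.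
  by have := rank_lt xE lt; rewrite -/r; lia.
by have := rank_lt yE lt; rewrite -/r; lia.
Qed.

(** With the threshold at [w], old pairs have both labels above it and new pairs exactly one. A new
    sum is at most [2 * w + M], and an old sum exceeded [M] before it grew by [2 * w]. So [good2]
    alone is upgraded to [goodZ]. *)
Lemma goodZ_cpeel : goodZ w (cpeel c).
Proof.
have all0 (l : seq nat) : (forall x : nat, x \in l -> 0 < x) ->
    count (ltn w) (map (addn w) l) = size l.
  by move=> l0; rewrite count_map -[RHS](count_predT l); apply: eq_in_count => x /l0 /=; lia.
have clsO (e : nat * nat) : e \in cD c -> cls w (w + e.1, w + e.2) = 2.
  by move/(g_pos G); rewrite /cls /=; lia.
have clsN (x : nat) : x \in cE c -> cls w (w + x, r x) = 1.
  by move=> xE; have := r_le xE; have := E0 xE; rewrite /cls /=; lia.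
have NO (x : nat) (e : nat * nat) : x \in cE c -> e \in cD c ->
    psum (w + x, r x) < psum (w + e.1, w + e.2).
  move=> xE eD; have := r_le xE; have := g_leaf G xE; have := g_low G eD.
  by rewrite /psum /=; lia.
have w3 : 3 * w <= w * size (cV c) by rewrite mulnC leq_mul2l; case/andP: s3 => ->; rewrite orbT.
split; last 2 first.
- by move=> d /mem_cpeel[[e eD ->]|[x xE ->]]; rewrite ?clsO ?clsN.
- by rewrite /= all0 //; lia.
split.
- rewrite /= cat_uniq map_inj_uniq ?(g_uniq G) /=; last exact: addnI.
  rewrite map_inj_in_uniq ?uE ?andbT.
    apply/hasPn => _ /mapP[x xE ->]; apply/negP => /mapP[y /(g_bnd G) Hy].
    by have := r_le xE; rewrite /r; lia.
  move=> x y xE yE Exy; case: (ltngtP x y) => // lt.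
    by have := rank_lt xE lt; rewrite Exy ltnn.
  by have := rank_lt yE lt; rewrite Exy ltnn.
- move=> x /=; rewrite size_cat !size_map mem_cat -/w.
  case/orP => /mapP[y]; first by move/(g_bnd G); lia.
  by move/r_le; rewrite -/r; lia.
- by rewrite /= size_cat !size_map -/w; lia.
- move=> d /mem_cpeel[[e /(g_pos G) eD ->]|[x xE ->]] /=; first lia.
  by have := E0 xE; have := r_le xE; lia.
- rewrite /= map_cat cat_uniq; apply/and3P; split.
  + by apply: (@uniq_sums_cat_map _ [::]) (g_sums G) _ _ => // p q _ _; rewrite /psum /=; lia.
  + apply/hasPn => _ /mapP[_ /mapP[x xE ->] ->]; apply/negP => /mapP[_ /mapP[e eD ->]].
    by have := NO x e xE eD; rewrite /both /r /w => /[swap] ->; rewrite ltnn.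
  + rewrite -map_comp map_inj_in_uniq // => x y xE yE /=; rewrite /psum /=.
    by apply: r_sum.
- by move=> x /= /mapP[y /r_le]; rewrite -/r; lia.
- move=> d /mem_cpeel[[e /(g_pos G) eD ->]|[x xE ->]]; rewrite /psum /=; first lia.
  by have := E0 xE; have := r_le xE; lia.
- move=> d d' /mem_cpeel[[e eD ->]|[x xE ->]] /mem_cpeel[[e' eD' ->]|[x' xE' ->]].
  + by rewrite !clsO.
  + by rewrite clsO ?clsN.
  + by move=> _; apply: NO.
  + by rewrite !clsN.
- move=> d /mem_cpeel[[e eD ->]|[x xE ->]]; rewrite /= sumn_add -/w /psum /=.
    by have := g_V G eD; rewrite /psum; lia.
  by have := g_leaf G xE; have := g_MV G; have := r_le xE; lia.
- by rewrite /= sumn_add -/w; have := g_MV G; lia.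
- rewrite /= !sumn_add -/w; have := g_UV G.
  have : w * size (cV c) <= w * size (cU c) by rewrite leq_mul2l; lia.
  lia.
- by rewrite /= !all0 //; lia.
Qed.

End Peel.

(** * Adding a leg of length one and a long even leg *)

(** The thresholds cut the labels into four blocks: below [s1], up to [s], below [c2], and from [c2]
    on. A vertex of degree two joins blocks one and three, two and four, or four and one of the last
    two. The first kind has sums of at most [s1 + c2 - 2], the second of at least [s1 + c2], the
    third above [c2 + s]; new sums are placed in the gaps between these kinds. *)
Record good3 (s s1 c2 : nat) (c : cfg) : Prop := Good3 {
  t_Z : goodZ s c;
  t_s1 : 0 < s1 <= s.+1;
  t_c2 : s < c2 <= (size (cL c)).+1;
  t_D : forall d : nat * nat, d \in cD c ->
    [|| (minn d.1 d.2 < s1) && (s < maxn d.1 d.2 < c2),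
        (s1 <= minn d.1 d.2 <= s) && (c2 <= maxn d.1 d.2) |
        (s < minn d.1 d.2) && (c2 <= maxn d.1 d.2)];
  t_1 : forall d : nat * nat, d \in cD c -> cls s d = 1 -> psum d <= c2 + s;
  t_2 : forall d d' : nat * nat, d \in cD c -> d' \in cD c -> cls s d = 2 -> cls s d' = 2 ->
    cls c2.-1 d < cls c2.-1 d' -> psum d < psum d';
  t_V : c2 + s < sumn (cV c);
  t_kV : 1 < count (ltn s) (cV c);
  t_k1 : count (leq s1) (cV c) <= (count (leq s1) (cU c)).+1;
  t_k2 : count (leq c2) (cV c) <= (count (leq c2) (cU c)).+1;
  t_s : 1 < s }.

(** The second block is empty here. A new pair contains an old leaf label, at most [s] before the
    shift, so it joins the first and third block. An old pair has, by [goodZ], a label that was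
    above [s], and this one now lies in the fourth block. *)
Lemma good3_cpeel s c (w := size (cE c)) : goodZ s c -> 3 <= size (cV c) <= size (cU c) ->
  1 < w -> uniq (cE c) -> (forall x : nat, x \in cE c -> 0 < x) ->
  (forall x : nat, x \in cU c -> 0 < x) -> (forall x : nat, x \in cV c -> 0 < x) ->
  good3 w w.+1 (s + w).+1 (cpeel c).
Proof.
move=> [G Zc ZV] s3 w1 uE E0 U0 V0.
have GZ := goodZ_cpeel G s3 uE E0 U0 V0.
have memP := @mem_cpeel c.
have rP (x : nat) := @r_le c x.
have w3 : 3 * w <= w * size (cV c) by rewrite mulnC leq_mul2l; case/andP: s3 => ->; rewrite orbT.
have cntS (l : seq nat) : (forall x : nat, x \in l -> 0 < x) ->
    count (leq w.+1) (map (addn w) l) = size l.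
  by move=> l0; rewrite count_map -[RHS](count_predT l); apply: eq_in_count => x /l0 /=; lia.
have cntC (l : seq nat) : count (leq (s + w).+1) (map (addn w) l) = count (ltn s) l.
  by rewrite count_map; apply: eq_count => x /=; lia.
split => //.
- by rewrite leqnn.
- by rewrite /= size_cat !size_map; have := g_size G; lia.
- move=> d /memP[[e eD ->]|[x xE ->]] /=.
    by have := g_pos G eD; have := Zc _ eD; rewrite /cls -/w; lia.
  by have := rP x xE; have := g_leaf G xE; have := E0 x xE; rewrite -/w; lia.
- move=> d /memP[[e eD ->]|[x xE ->]]; rewrite /cls /psum /= -/w.
    by have := g_pos G eD; lia.
  by have := rP x xE; have := g_leaf G xE; rewrite -/w; lia.
- move=> d d' /memP[[e eD ->]|[x xE ->]] /memP[[e' eD' ->]|[x' xE' ->]]; last 3 first.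
  + by have := rP x' xE'; rewrite /cls /= -/w; lia.
  + by have := rP x xE; rewrite /cls /= -/w; lia.
  + by have := rP x xE; rewrite /cls /= -/w; lia.
  move=> _ _; rewrite -/w /cls /= => Hc.
  suff : psum e < psum e' by rewrite /psum /=; lia.
  by apply: (g_cls G) => //; rewrite /cls; lia.
- by rewrite /= sumn_add -/w; have := g_MV G; lia.
- have := z_V GZ; rewrite /= !count_map -/w => _.
  have -> : count (preim (addn w) (ltn w)) (cV c) = size (cV c); last lia.
  by rewrite -[RHS](count_predT (cV c)); apply: eq_in_count => x /V0 /=; lia.
- by rewrite /= !cntS //; lia.
- by rewrite /= !cntC; apply: g_kap G.
Qed.

(** For [s1 <= s.+1] and [s < c2] this leaves free the labels of the two new legs: 1 to [g],
    [s1 + g], the [g.+1] labels from [s + g + 2] on, and [c2 + 2 * g + 2]. *)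
Definition sh4 (g s s1 c2 x : nat) : nat :=
  x + g + (s1 <= x) + (if s < x then g.+1 else 0) + (c2 <= x).

Lemma sumn_sh4 g s s1 c2 l : sumn (map (sh4 g s s1 c2) l) =
  sumn l + g * size l + count (leq s1) l + g.+1 * count (ltn s) l + count (leq c2) l.
Proof.
elim: l => [|x l IHl] /=; first by rewrite !muln0.
by rewrite IHl /sh4 mulnS; case: (s < x) => /=; rewrite ?mulnDr; lia.
Qed.

(* The new leg of [v] zigzags away from the hub, except that its last two labels lie just
   below the two top blocks: the pair of large labels this creates has a sum larger than all
   sums of a small and a large label. *)
Lemma good3_add_pair g s s1 c2 c (s' := s + g + 2) (C := c2 + 2 * g + 2)
    (leg := zig (2 * g) 1 s'.+1 ++ [:: C; s1 + g]) :
  good3 s s1 c2 c -> 3 <= size (cV c) <= size (cU c) -> 0 < g ->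
  good3 s' (s1 + g) C
    (cext (sh4 g s s1 c2) (s' :: leg) (adjs leg) [:: s'; s1 + g] [:: s'] [:: 1] c).
Proof.
move=> T s3 g0.
have s'E : s' = s + g + 2 by [].
have CE : C = c2 + 2 * g + 2 by [].
clearbody s' C.
have [G Zc ZV] := t_Z T; set f := sh4 g s s1 c2.
have /andP[s10 Hs1] := t_s1 T; have /andP[Hc2 Hc2m] := t_c2 T; have Hs := t_s T.
have bnd (x : nat) : x \in zig (2 * g) 1 s'.+1 -> (0 < x <= g) || (s' < x <= s' + g).
  by move/mem_zig; lia.
have lastz : last 0 (zig (2 * g) 1 s'.+1) = s' + g.
  have -> : 2 * g = (2 * g).-1.+1 by lia.
  rewrite [last _ _]/= last_zig; have -> : odd (2 * g).-1 by lia.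
  lia.
have adjE : adjs leg = adjs (zig (2 * g) 1 s'.+1) ++ [:: (s' + g, C); (C, s1 + g)].
  rewrite /leg -lastz; have -> : 2 * g = (2 * g).-1.+1 by lia.
  exact: adjs_cat.
have sE := zig_sums (2 * g) 1 s'.+1.
have memd (d : nat * nat) : d \in adjs leg ->
    [\/ [/\ s' + 2 <= psum d <= s' + 2 * g, cls s' d = 1, minn d.1 d.2 < s1 + g,
            s' < maxn d.1 d.2 < C & 0 < minn d.1 d.2],
        d = (s' + g, C) | d = (C, s1 + g)].
  rewrite adjE mem_cat !inE => /or3P[dz|/eqP->|/eqP->]; last 2 first.
  - by constructor 2.
  - by constructor 3.
  constructor 1; have := mem_adjs_zig dz; have := map_f psum dz.
  rewrite sE mem_iota /cls /psum => H1 H2.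
  by split; lia.
have fS (x : nat) : x < s1 -> f x = x + g by rewrite /f /sh4; case: ifP; lia.
have fT (x : nat) : s1 <= x <= s -> f x = x + g + 1 by rewrite /f /sh4; case: ifP; lia.
have fC (x : nat) : s < x < c2 -> f x = x + 2 * g + 2 by rewrite /f /sh4; case: ifP; lia.
have fD (x : nat) : c2 <= x -> f x = x + 2 * g + 3 by rewrite /f /sh4; case: ifP; lia.
have fhomo : {homo f : x y / x < y}.
  by move=> x y; rewrite /f /sh4; do 2 case: ifP; lia.
(* The last case of [t_D] splits according to whether the smaller label also reaches [c2]. *)
have oldd (d : nat * nat) : d \in cD c ->
    [\/ [/\ cls s d = 1, psum d <= s1 + c2 - 2, psum (both f d) = psum d + 3 * g + 2,
            minn (f d.1) (f d.2) < s1 + g & s' < maxn (f d.1) (f d.2) < C],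
        [/\ cls s d = 1, s1 + c2 <= psum d, psum (both f d) = psum d + 3 * g + 4,
            s1 + g <= minn (f d.1) (f d.2) <= s' & C <= maxn (f d.1) (f d.2)],
        [/\ cls s d = 2, cls c2.-1 d = 1, psum (both f d) = psum d + 4 * g + 5,
            s' < minn (f d.1) (f d.2) & C <= maxn (f d.1) (f d.2)] |
        [/\ cls s d = 2, cls c2.-1 d = 2, psum (both f d) = psum d + 4 * g + 6,
            s' < minn (f d.1) (f d.2) & C <= maxn (f d.1) (f d.2)]].
  move=> dD; rewrite /cls /psum /both /=.
  have: exists x y, [/\ x = minn d.1 d.2, y = maxn d.1 d.2 & (d.1 = x /\ d.2 = y) \/ (d.1 = y /\ d.2 = x)].
    by exists (minn d.1 d.2), (maxn d.1 d.2); split => //; lia.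
  case=> x [y [Ex Ey Exy]]; have := t_D T dD; rewrite -Ex -Ey => /or3P[] /andP[Hx Hy].
  - have := fS x Hx; have := fC y Hy => fy fx.
    by constructor 1; case: Exy => -[-> ->]; rewrite fx fy; split; lia.
  - have := fT x Hx; have := fD y Hy => fy fx.
    by constructor 2; case: Exy => -[-> ->]; rewrite fx fy; split; lia.
  - case: (ltnP x c2) => Hxc.
      have fx := fC x (introT andP (conj Hx Hxc)); have fy := fD y Hy.
      by constructor 3; case: Exy => -[-> ->]; rewrite fx fy; split; lia.
    have fx := fD x Hxc; have fy := fD y Hy.
    by constructor 4; case: Exy => -[-> ->]; rewrite fx fy; split; lia.
have Dlow (d : nat * nat) : d \in cD c -> s + 2 <= psum d.
  by move=> dD; have := Zc _ dD; have := g_pos G dD; rewrite /cls /psum; lia.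
have D2 (d : nat * nat) : d \in cD c -> cls s d = 2 -> c2 + s < psum d.
  by move=> dD; have := t_D T dD; rewrite /cls /psum; lia.
have mono (d d' : nat * nat) : d \in cD c -> d' \in cD c -> psum d < psum d' ->
    psum (both f d) < psum (both f d').
  move=> dD dD' lt; have H1 := @g_cls _ _ G d' d dD' dD; have H2 := t_2 T dD' dD.
  by case: (oldd d dD) => -[? ? -> _ _]; case: (oldd d' dD') => -[? ? -> _ _]; lia.
have cls1 (d : nat * nat) : d \in cD c -> cls s' (both f d) = cls s d.
  by case/oldd => -[]; rewrite /cls /=; lia.
have cls2 (d : nat * nat) : d \in cD c -> cls s d = 2 ->
    cls C.-1 (both f d) = cls c2.-1 d.
  by move=> _; rewrite /cls /= /f /sh4; do 2 case: ifP; lia.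
(* This sum lies between the old pairs with one large label, now at most [c2 + s + 3 * g + 4], and
   those with two, now at least [c2 + s + 4 * g + 6]; the first gap needs [0 < g]. The next sum lies
   between the first kind, at most [c2 + s1 + 3 * g], and the second, at least
   [c2 + s1 + 3 * g + 4]. *)
have F3E : psum (s' + g, C) = c2 + s + 4 * g + 4 by rewrite /psum /=; lia.
have F2E : psum (C, s1 + g) = c2 + s1 + 3 * g + 2 by rewrite /psum /=; lia.
have F3c : cls s' (s' + g, C) = 2 by rewrite /cls /=; lia.
have F2c : cls s' (C, s1 + g) = 1 by rewrite /cls /=; lia.
have F3c' : cls C.-1 (s' + g, C) = 1 by rewrite /cls /=; lia.
have lega (d : nat * nat) : d \in adjs leg ->
    (cls s' d = 1 /\ psum d <= c2 + s1 + 3 * g + 2) \/ d = (s' + g, C).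
  case/memd => [[H1 H2 _ _ _]|->|->]; [left|by right|left]; split => //; try lia.
have sleg : size leg = 2 * g + 2 by rewrite size_cat size_zig.
have szL : size ((s' :: leg) ++ map f (cL c)) = 2 * g + 3 + size (cL c).
  by rewrite size_cat size_map /= sleg; lia.
have memleg (x : nat) : x \in s' :: leg ->
    [|| 0 < x <= g, s' <= x <= s' + g, x == C | x == s1 + g].
  by rewrite inE mem_cat !inE => /or4P[/eqP->|/bnd|/eqP->|/eqP->]; lia.
have cnt1 (l : seq nat) : count (ltn s') (map f l) = count (ltn s) l.
  by rewrite count_map; apply: eq_count => x /=; rewrite /f /sh4; case: ifP; lia.
have cnt2 (l : seq nat) : count (leq (s1 + g)) (map f l) = count (leq s1) l.
  by rewrite count_map; apply: eq_count => x /=; rewrite /f /sh4; case: ifP; lia.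
have cnt3 (l : seq nat) : count (leq C) (map f l) = count (leq c2) l.
  by rewrite count_map; apply: eq_count => x /=; rewrite /f /sh4; case: ifP; lia.
have V12 : count (ltn s) (cV c) <= count (leq s1) (cV c).
  by apply: sub_count => x /=; lia.
have kV := t_kV T.
have Vsz : 3 * g <= g * size (cV c) by rewrite mulnC leq_mul2l; case/andP: s3 => ->; rewrite orbT.
have Vcn : 2 * g.+1 <= g.+1 * count (ltn s) (cV c) by rewrite mulnC leq_mul2l kV orbT.
have VE : sumn ([:: 1] ++ map f (cV c)) = 1 + sumn (cV c) + g * size (cV c) +
    count (leq s1) (cV c) + g.+1 * count (ltn s) (cV c) + count (leq c2) (cV c).
  by rewrite sumn_cat sumn_sh4 /=; lia.
have UE : sumn ([:: s'] ++ map f (cU c)) = s' + sumn (cU c) + g * size (cU c) +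
    count (leq s1) (cU c) + g.+1 * count (ltn s) (cU c) + count (leq c2) (cU c).
  by rewrite sumn_cat sumn_sh4 /=; lia.
have UVg : g * size (cV c) <= g * size (cU c) by rewrite leq_mul2l; case/andP: s3 => _ ->; rewrite orbT.
have UVc : g.+1 * count (ltn s) (cV c) <= g.+1 * count (ltn s) (cU c) + g.+1.
  by rewrite -mulnSr leq_mul2l (g_kap G) orbT.
have k1 := t_k1 T; have k2 := t_k2 T; have kap := g_kap G; have HV := t_V T.
have ltUV := g_UV G.
have oldV (e : nat * nat) : e \in cD c -> psum (both f e) < sumn ([:: 1] ++ map f (cV c)).
  by move=> eD; rewrite VE; have := g_V G eD; case: (oldd e eD) => -[_ _ -> _ _]; lia.
have new_old (d e : nat * nat) : d \in adjs leg -> e \in cD c -> cls s' d < cls s e ->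
    psum d < psum (both f e).
  move=> /lega[[Hd Hs'] |-> ] eD; last by rewrite F3c /cls; lia.
  by rewrite Hd => He; case: (oldd e eD) => -[E1 _ -> _ _]; try lia; have := D2 e eD E1; lia.
have old_new (d e : nat * nat) : d \in adjs leg -> e \in cD c -> cls s e < cls s' d ->
    psum (both f e) < psum d.
  move=> /lega[[-> _] |-> ] eD; first by have := Zc e eD; lia.
  rewrite F3c F3E => He; have := t_1 T eD.
  by case: (oldd e eD) => -[E1 _ -> _ _]; lia.
have dis (d e : nat * nat) : d \in adjs leg -> e \in cD c -> psum d != psum (both f e).
  case/memd => [[H1 _ _ _ _]|->|->] eD; have De := Dlow e eD.
  - by case: (oldd e eD) => -[_ _ -> _ _]; lia.
  - rewrite F3E; have := t_1 T eD; have := D2 e eD.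
    by case: (oldd e eD) => -[E1 _ -> _ _]; lia.
  - rewrite F2E; have := D2 e eD.
    by case: (oldd e eD) => -[E1 E2 -> _ _]; lia.
have zigu : uniq (map psum (adjs leg)).
  rewrite adjE map_cat sE cat_uniq iota_uniq /= F3E F2E !inE !mem_iota; lia.
have goodN : good2 s' (cext f (s' :: leg) (adjs leg) [:: s'; s1 + g] [:: s'] [:: 1] c).
  split.
  - apply: uniq_cat_map (g_uniq G) fhomo _; last first.
      by move=> x y /memleg Hx /(g_bnd G) Hy; rewrite /f /sh4; case: ifP; lia.
    rewrite cons_uniq cat_uniq zig_uniq ?mem_cat; last lia.
    rewrite /= !inE !negb_or; apply/and3P; split; last by lia.
      by apply/and3P; split; [apply/negP => /bnd; lia | lia | lia].
    by apply/and3P; split=> //; apply/negP => /bnd; lia.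
  - move=> x; rewrite szL /= => Hx; have : x \in (s' :: leg) ++ map f (cL c) by [].
    rewrite mem_cat => /orP[/memleg|/mapP[y /(g_bnd G) Hy ->]]; first by have := g_size G; lia.
    by rewrite /f /sh4; case: ifP; lia.
  - by rewrite szL; have := g_size G; lia.
  - move=> d /=; rewrite mem_cat => /orP[/memd[[_ _ _ H1 H2]|->|->]|/mapP[e /(g_pos G) He ->]] /=.
    + lia.
    + lia.
    + lia.
    + by rewrite /f /sh4; lia.
  - exact: uniq_sums_cat_map (g_sums G) mono dis.
  - move=> x /=; rewrite !inE orbA => /orP[|/mapP[y /(g_leaf G) Hy ->]]; first lia.
    by rewrite /f /sh4; case: ifP; lia.
  - move=> d /=; rewrite mem_cat => /orP[/memd[[H1 _ _ _ _]|->|->]|/mapP[e eD ->]].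
    + lia.
    + lia.
    + lia.
    + by have := Dlow e eD; case: (oldd e eD) => -[_ _ -> _ _]; lia.
  - move=> d d' /=; rewrite !mem_cat => /orP[Hd|/mapP[e eD ->]] /orP[Hd'|/mapP[e' eD' ->]].
    + case: (lega d Hd) => [[-> Hs1']|->]; case: (lega d' Hd') => [[-> Hs2]|->]; rewrite ?ltnn ?F3c //.
      by rewrite F3E; lia.
    + by rewrite (cls1 e') //; apply: new_old.
    + by rewrite (cls1 e) //; apply: old_new.
    + by rewrite !cls1 // => Hc; apply: mono => //; apply: (g_cls G).
  - move=> d /=; rewrite mem_cat => /orP[/lega[[_ H]|->]|/mapP[e eD ->]].
    + by have := VE; rewrite /=; lia.
    + by have := VE; rewrite F3E /=; lia.
    + exact: oldV.
  - by have := VE; rewrite /=; lia.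
  (* By the three counting conditions and its new label 1, v gains at most [g + 4] more than u does
     from the old labels. The label [s' = s + g + 2] at u covers this because [1 < s]. *)
  - by have := VE; have := UE; rewrite /=; lia.
  - by rewrite /= !cnt1 -/s'; lia.
split.
- split => //.
  + move=> d /=; rewrite mem_cat => /orP[/lega[[-> _]|->]|/mapP[e eD ->]] //.
      by rewrite F3c.
    by rewrite cls1 //; apply: Zc.
  + by rewrite /= cnt1; lia.
- lia.
- by rewrite szL; lia.
- move=> d /=; rewrite mem_cat => /orP[/memd[[_ _ H1 H2 _]|->|->]|/mapP[e eD ->]].
  + by rewrite H1 H2.
  + by rewrite /=; lia.
  + by rewrite /=; lia.
  + by case: (oldd e eD) => -[_ _ _ /= H1 H2]; lia.
- move=> d /=; rewrite mem_cat => /orP[/lega[[_ H]|->]|/mapP[e eD ->]].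
  + lia.
  + by rewrite F3c.
  + rewrite cls1 // => H1; have := t_1 T eD H1.
    by case: (oldd e eD) => -[E1 _ -> _ _]; lia.
- move=> d d' /=; rewrite !mem_cat => /orP[/lega Hd|/mapP[e eD ->]] /orP[/lega Hd'|/mapP[e' eD' ->]].
  + by case: Hd => [[-> _]|->] //; case: Hd' => [[-> _]|->] //; rewrite ltnn.
  + case: Hd => [[-> _]|->] //; rewrite cls1 // => _ E2 _; rewrite F3E.
    have := D2 e' eD' E2; case: (oldd e' eD') => -[E1 _ -> _ _]; lia.
  + case: Hd' => [[-> _]|->] //; rewrite cls1 // => E2 _; rewrite cls2 // F3c'.
    by case: (oldd e eD) => -[E1 E3 _ _ _]; lia.
  + by rewrite !cls1 // => E1 E2; rewrite !cls2 // => Hc; apply: mono => //; apply: (t_2 T).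
- by have := VE; rewrite /=; lia.
- by rewrite /= cnt1; lia.
- by rewrite /= !cnt2; lia.
- by rewrite /= !cnt3; lia.
- lia.
Qed.

(** * Labelled double spiders *)

(* Legs are listed from the hub to the leaf, the core from [u] to [v]. *)
Definition spider (core : seq nat) (LU LV : seq (seq nat)) : cfg :=
  Cfg (core ++ flatten LU ++ flatten LV)
      (adjs core ++ flatten (map adjs LU) ++ flatten (map adjs LV))
      (map (last 0) LU ++ map (last 0) LV)
      (head 0 core :: map (head 0) LU)
      (last 0 core :: map (head 0) LV).

(** The invariants do not depend on the order within the lists. *)
Definition cperm (c c' : cfg) : Prop :=
  [/\ perm_eq (cL c) (cL c'), perm_eq (cD c) (cD c'), perm_eq (cE c) (cE c'),
      perm_eq (cU c) (cU c') & perm_eq (cV c) (cV c')].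

Lemma good2_perm M c c' : cperm c c' -> good2 M c -> good2 M c'.
Proof.
case=> pL pD pE pU pV [g1 g2 g3 g4 g5 g6 g7 g8 g9 g10 g11 g12].
split.
- by rewrite -(perm_uniq pL).
- by move=> x; rewrite -(perm_mem pL) -(perm_size pL); apply: g2.
- by rewrite -(perm_size pL).
- by move=> d; rewrite -(perm_mem pD); apply: g4.
- by rewrite -(perm_uniq (perm_map psum pD)).
- by move=> x; rewrite -(perm_mem pE); apply: g6.
- by move=> d; rewrite -(perm_mem pD); apply: g7.
- by move=> d d'; rewrite -!(perm_mem pD); apply: g8.
- by move=> d; rewrite -(perm_mem pD) -(perm_sumn pV); apply: g9.
- by rewrite -(perm_sumn pV).
- by rewrite -(perm_sumn pV) -(perm_sumn pU).
- by rewrite -!(permP pV) -!(permP pU).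
Qed.

Lemma goodZ_perm s c c' : cperm c c' -> goodZ s c -> goodZ s c'.
Proof.
move=> p [G z1 z2]; split; first exact: good2_perm p G.
  by case: p => _ pD _ _ _ d; rewrite -(perm_mem pD); apply: z1.
by case: p => _ _ _ _ pV; rewrite -(permP pV).
Qed.

Lemma good3_perm s s1 c2 c c' : cperm c c' -> good3 s s1 c2 c -> good3 s s1 c2 c'.
Proof.
move=> p [z h1 h2 h3 h4 h5 h6 h7 h8 h9 h10].
have [pL pD _ pU pV] := p.
split => //; first exact: goodZ_perm p z.
- by rewrite -(perm_size pL).
- by move=> d; rewrite -(perm_mem pD); apply: h3.
- by move=> d; rewrite -(perm_mem pD); apply: h4.
- by move=> d d'; rewrite -!(perm_mem pD); apply: h5.
- by rewrite -(perm_sumn pV).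
- by rewrite -(permP pV).
- by rewrite -(permP pV) -(permP pU).
- by rewrite -(permP pV) -(permP pU).
Qed.

Definition nonnil (s : seq nat) := 0 < size s.

Lemma head_map_nonnil (f : nat -> nat) s : nonnil s -> head 0 (map f s) = f (head 0 s).
Proof. by case: s. Qed.

Lemma last_map_nonnil (f : nat -> nat) s : nonnil s -> last 0 (map f s) = f (last 0 s).
Proof. by case: s => //= x s _; rewrite last_map. Qed.

Lemma flatten_adjs_map (f : nat -> nat) ss :
  flatten (map adjs (map (map f) ss)) = map (both f) (flatten (map adjs ss)).
Proof. by rewrite map_flatten -!map_comp; congr flatten; apply: eq_map => s /=; apply: adjs_map. Qed.

Lemma spider_ext f core LU LV nu nv : nonnil core -> all nonnil LU -> all nonnil LV ->
  cperm (cext f (flatten nu ++ flatten nv) (flatten (map adjs nu) ++ flatten (map adjs nv))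
              (map (last 0) nu ++ map (last 0) nv) (map (head 0) nu) (map (head 0) nv)
              (spider core LU LV))
        (spider (map f core) (nu ++ map (map f) LU) (nv ++ map (map f) LV)).
Proof.
move=> c0 U0 V0.
have hd ss : all nonnil ss -> map (head 0) (map (map f) ss) = map f (map (head 0) ss).
  move=> /allP s0; rewrite -!map_comp; apply/eq_in_map => s /s0 ? /=; exact: head_map_nonnil.
have la ss : all nonnil ss -> map (last 0) (map (map f) ss) = map f (map (last 0) ss).
  move=> /allP s0; rewrite -!map_comp; apply/eq_in_map => s /s0 ? /=; exact: last_map_nonnil.
split; rewrite /= ?flatten_cat ?map_cat ?flatten_cat ?flatten_adjs_map ?hd ?la //
   ?head_map_nonnil ?last_map_nonnil // ?map_cat ?map_flatten ?adjs_map.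
- by rewrite -!catA; apply/permP => p; rewrite !count_cat; lia.
- by rewrite -!catA; apply/permP => p; rewrite !count_cat; lia.
- by apply/permP => p; rewrite !count_cat; lia.
- by apply/permP => p; rewrite /= !count_cat /=; lia.
- by apply/permP => p; rewrite /= !count_cat /=; lia.
Qed.

Lemma spider_rcons (w : nat) (rk : nat -> nat) core LU LV (c := spider core LU LV)
    (ext := fun l => rcons (map (addn w) l) (rk (last 0 l))) :
  nonnil core -> all nonnil LU -> all nonnil LV ->
  cperm (Cfg (map (addn w) (cL c) ++ map rk (cE c))
             (map (both (addn w)) (cD c) ++ [seq (w + x, rk x) | x <- cE c])
             (map rk (cE c)) (map (addn w) (cU c)) (map (addn w) (cV c)))
        (spider (map (addn w) core) (map ext LU) (map ext LV)).
Proof.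
move=> c0 U0 V0.
have hd ss : all nonnil ss -> map (head 0) (map ext ss) = map (addn w) (map (head 0) ss).
  by move=> /allP s0; rewrite -!map_comp; apply/eq_in_map => -[|x s] // /s0.
have la ss : map (last 0) (map ext ss) = map (rk) (map (last 0) ss).
  by rewrite -!map_comp; apply: eq_map => s /=; rewrite last_rcons.
have fl ss : perm_eq (flatten (map ext ss))
    (map (addn w) (flatten ss) ++ map (rk) (map (last 0) ss)).
  apply/permP => p; elim: ss => //= s ss IHs.
  by rewrite !count_cat IHs /ext -cats1 map_cat !count_cat /=; lia.
have ad ss : all nonnil ss -> perm_eq (flatten (map adjs (map ext ss)))
    (map (both (addn w)) (flatten (map adjs ss)) ++
     [seq (w + x, rk x) | x <- map (last 0) ss]).
  move=> /allP s0; apply/permP => p; elim: ss s0 => //= s ss IHs s0.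
  rewrite !count_cat IHs; last by move=> t ts; apply: s0; rewrite inE ts orbT.
  have : nonnil s by apply: s0; rewrite mem_head.
  case: s {s0} => // x s _; rewrite [adjs (ext _)]/= map_cat !count_cat.
  have -> : adjs (ext (x :: s)) =
      rcons (map (both (addn w)) (adjs (x :: s))) (w + last x s, rk (last x s)).
    by rewrite /ext map_cons adjs_rcons -map_cons adjs_map last_map.
  by rewrite -cats1 !count_cat /=; lia.
split.
- apply/permP => p; rewrite /= !count_cat (permP (fl LU)) (permP (fl LV)) !map_cat !count_cat.
  by rewrite -addnA addnACA.
- apply/permP => p.
  by rewrite /= !count_cat (permP (ad _ U0)) (permP (ad _ V0)) adjs_map !map_cat !count_cat -addnA addnACA.
- by apply/permP => p; rewrite /= !la map_cat.
- by apply/permP => p; rewrite /= hd // head_map_nonnil.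
- by apply/permP => p; rewrite /= hd // last_map_nonnil.
Qed.

Lemma spider_peel core LU LV (c := spider core LU LV) (w := size (cE c))
    (ext := fun l => rcons (map (addn w) l) (rank (cE c) (last 0 l))) :
  nonnil core -> all nonnil LU -> all nonnil LV ->
  cperm (cpeel c) (spider (map (addn w) core) (map ext LU) (map ext LV)).
Proof. exact: spider_rcons. Qed.

(** * Leg lengths that admit a labelling *)

(** [L] is the length of the core; [A] and [B] are the leg lengths at u and v, up to order. *)
Definition realizable (P : cfg -> Prop) (L : nat) (A B : seq nat) : Prop :=
  exists core LU LV, [/\ size core = L, perm_eq (map size LU) A, perm_eq (map size LV) B &
                         P (spider core LU LV)].

Definition has2 := realizable (fun c => exists M, good2 M c).
Definition hasZ := realizable (fun c => exists s, goodZ s c).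
Definition has3 := realizable (fun c => exists s s1 c2, good3 s s1 c2 c).

Lemma has3Z L A B : has3 L A B -> hasZ L A B.
Proof.
case=> core [LU [LV [h1 h2 h3 [s [s1 [c2 T]]]]]].
by exists core, LU, LV; split => //; exists s; apply: t_Z T.
Qed.

Lemma hasZ2 L A B : hasZ L A B -> has2 L A B.
Proof.
case=> core [LU [LV [h1 h2 h3 [s G]]]].
by exists core, LU, LV; split => //; exists s; apply: z_good2 G.
Qed.

Lemma realizable_perm P L A B A' B' : perm_eq A A' -> perm_eq B B' ->
  realizable P L A B -> realizable P L A' B'.
Proof.
move=> pA pB [core [LU [LV [h1 h2 h3 h4]]]]; exists core, LU, LV.
by split => //; [apply: perm_trans h2 pA | apply: perm_trans h3 pB].
Qed.

Definition pos := all (ltn 0).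

Lemma pos_nonnil (A : seq nat) (ss : seq (seq nat)) : perm_eq (map size ss) A -> pos A -> all nonnil ss.
Proof. by move=> p; rewrite /pos -(perm_all _ p) all_map. Qed.

Lemma perm_map_size (f : nat -> nat) (ss : seq (seq nat)) (A : seq nat) :
  perm_eq (map size ss) A -> perm_eq (map size (map (map f) ss)) A.
Proof. by rewrite -map_comp (eq_map (g := size)) // => s /=; rewrite size_map. Qed.

Lemma size_perm_map (ss : seq (seq nat)) (A : seq nat) : perm_eq (map size ss) A -> size ss = size A.
Proof. by move/perm_size; rewrite size_map. Qed.

Section Operations.
Variables (L : nat) (A B : seq nat).
Hypotheses (L0 : 0 < L) (A0 : pos A) (B0 : pos B).

Lemma hasZ_add_u n : hasZ L A B -> 0 < n -> 2 <= size B <= size A -> hasZ L (n :: A) B.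
Proof.
move=> [core [LU [LV [h1 h2 h3 [s G]]]]] n0 sAB.
have c0 : nonnil core by rewrite /nonnil h1.
have U0 := pos_nonnil h2 A0; have V0 := pos_nonnil h3 B0.
have s3 : 3 <= size (cV (spider core LU LV)) <= size (cU (spider core LU LV)).
  by rewrite /= !size_map (size_perm_map h2) (size_perm_map h3); lia.
have := goodZ_add_u G s3 n0; set k := uphalf n; set leg := rev _ => G'.
exists (map (sh k s n./2) core), (leg :: map (map (sh k s n./2)) LU), (map (map (sh k s n./2)) LV).
split; rewrite ?size_map //=; last exists (s + k).
- by rewrite size_rev size_zig perm_cons perm_map_size.
- exact: perm_map_size.
apply: goodZ_perm G'.
by have := @spider_ext (sh k s n./2) core LU LV [:: leg] [::] c0 U0 V0; rewrite /= !cats0.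
Qed.

Lemma hasZ_add_v n : hasZ L A B -> odd n -> 2 <= size B < size A -> hasZ L A (n :: B).
Proof.
move=> [core [LU [LV [h1 h2 h3 [s G]]]]] n0 sAB.
have c0 : nonnil core by rewrite /nonnil h1.
have U0 := pos_nonnil h2 A0; have V0 := pos_nonnil h3 B0.
have s3 : 3 <= size (cV (spider core LU LV)) < size (cU (spider core LU LV)).
  by rewrite /= !size_map (size_perm_map h2) (size_perm_map h3); lia.
have := goodZ_add_v G s3 n0; set k := uphalf n; set leg := zig _ _ _ => G'.
exists (map (sh k s n./2) core), (map (map (sh k s n./2)) LU), (leg :: map (map (sh k s n./2)) LV).
split; rewrite ?size_map //=; last exists (s + k).
- exact: perm_map_size.
- by rewrite size_zig perm_cons perm_map_size.
apply: goodZ_perm G'.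
by have := @spider_ext (sh k s n./2) core LU LV [::] [:: leg] c0 U0 V0; rewrite /= !cats0.
Qed.

Lemma has2_add_short : has2 L A B -> 2 <= size B <= size A -> has2 L (1 :: A) B.
Proof.
move=> [core [LU [LV [h1 h2 h3 [M G]]]]] sAB.
have c0 : nonnil core by rewrite /nonnil h1.
have U0 := pos_nonnil h2 A0; have V0 := pos_nonnil h3 B0.
have s3 : 3 <= size (cV (spider core LU LV)) <= size (cU (spider core LU LV)).
  by rewrite /= !size_map (size_perm_map h2) (size_perm_map h3); lia.
have G' := good2_add_short G s3; set f := sh 1 M 0 in G'.
exists (map f core), ([:: 1] :: map (map f) LU), (map (map f) LV).
split; rewrite ?size_map //=; last exists M.+1.
- by rewrite perm_cons perm_map_size.
- exact: perm_map_size.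
by apply: good2_perm G'; apply: (@spider_ext f core LU LV [:: [:: 1]] [::] c0 U0 V0).
Qed.

Lemma has2_add_pair : has2 L A B -> 2 <= size B <= size A -> has2 L (1 :: A) (2 :: B).
Proof.
move=> [core [LU [LV [h1 h2 h3 [M G]]]]] sAB.
have c0 : nonnil core by rewrite /nonnil h1.
have U0 := pos_nonnil h2 A0; have V0 := pos_nonnil h3 B0.
have s3 : 3 <= size (cV (spider core LU LV)) <= size (cU (spider core LU LV)).
  by rewrite /= !size_map (size_perm_map h2) (size_perm_map h3); lia.
have G' := good2_add_pair G s3; set f := sh 2 M 1 in G'.
exists (map f core), ([:: 2] :: map (map f) LU), ([:: 1; M + 3] :: map (map f) LV).
split; rewrite ?size_map //=; last exists (M + 3).
- by rewrite perm_cons perm_map_size.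
- by rewrite perm_cons perm_map_size.
by apply: good2_perm G'; apply: (@spider_ext f core LU LV [:: [:: 2]] [:: [:: 1; M + 3]] c0 U0 V0).
Qed.

Lemma has3_add_pair g : has3 L A B -> 0 < g -> 2 <= size B <= size A ->
  has3 L (1 :: A) (2 * g.+1 :: B).
Proof.
move=> [core [LU [LV [h1 h2 h3 [s [s1 [c2 G]]]]]]] g0 sAB.
have c0 : nonnil core by rewrite /nonnil h1.
have U0 := pos_nonnil h2 A0; have V0 := pos_nonnil h3 B0.
have s3 : 3 <= size (cV (spider core LU LV)) <= size (cU (spider core LU LV)).
  by rewrite /= !size_map (size_perm_map h2) (size_perm_map h3); lia.
have := good3_add_pair G s3 g0; set f := sh4 g s s1 c2.
set s' := s + g + 2; set C := c2 + _ + _; set leg := _ ++ [:: C; s1 + g] => G'.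
exists (map f core), ([:: s'] :: map (map f) LU), (leg :: map (map f) LV).
split; rewrite ?size_map //=; last exists s', (s1 + g), C.
- by rewrite perm_cons perm_map_size.
- rewrite size_cat size_zig /=; have -> : 2 * g + 2 = 2 * g.+1 by lia.
  by rewrite perm_cons perm_map_size.
apply: good3_perm G'.
have := @spider_ext f core LU LV [:: [:: s']] [:: leg] c0 U0 V0; rewrite /= !cats0.
have -> : last 0 leg = s1 + g by rewrite /leg last_cat.
by have -> : head 0 leg = 1 by rewrite /leg; case: (g) g0.
Qed.

Lemma peel_hyps M core LU LV (c := spider core LU LV) : good2 M c ->
  nonnil core -> all nonnil LU -> all nonnil LV ->
  [/\ uniq (cE c), forall x : nat, x \in cE c -> 0 < x,
      forall x : nat, x \in cU c -> 0 < x & forall x : nat, x \in cV c -> 0 < x].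
Proof.
move=> G c0 U0 V0; have uL := g_uniq G; have bL := g_bnd G.
have lastP (ss : seq (seq nat)) (x : nat) : all nonnil ss -> x \in map (last 0) ss ->
    x \in flatten ss.
  move=> /allP s0 /mapP[s ss_s ->]; apply/flattenP; exists s => //.
  by have := s0 _ ss_s; case: (s) => //= y t _; apply: mem_last.
have headP (ss : seq (seq nat)) (x : nat) : all nonnil ss -> x \in map (head 0) ss ->
    x \in flatten ss.
  move=> /allP s0 /mapP[s ss_s ->]; apply/flattenP; exists s => //.
  by have := s0 _ ss_s; case: (s) => //= y t _; apply: mem_head.
have lastu (ss : seq (seq nat)) : all nonnil ss -> uniq (flatten ss) -> uniq (map (last 0) ss).
  elim: ss => //= s ss IHs /andP[s0 ss0]; rewrite cat_uniq => /and3P[_ /hasPn dis us].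
  rewrite IHs // andbT; apply/negP => /(lastP _ _ ss0) /dis /negP; apply.
  by case: (s) s0 => //= y t _; apply: mem_last.
have EL : cL c = core ++ flatten (LU ++ LV) by rewrite flatten_cat.
have UV0 : all nonnil (LU ++ LV) by rewrite all_cat U0.
split.
- rewrite /= -map_cat; apply: lastu => //.
  by move: uL; rewrite EL cat_uniq => /and3P[].
- move=> x; rewrite /= -map_cat => /(lastP _ _ UV0) xL.
  by have := bL x; rewrite EL mem_cat xL orbT => /(_ isT) /andP[].
- move=> x; rewrite inE => H; suff /bL/andP[] : x \in cL c by [].
  case/orP: H => [/eqP->|/(headP _ _ U0) xU]; rewrite !mem_cat ?xU ?orbT //.
  by case: (core) c0 => //= y t _; rewrite mem_head.
- move=> x; rewrite inE => H; suff /bL/andP[] : x \in cL c by [].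
  case/orP: H => [/eqP->|/(headP _ _ V0) xU]; rewrite !mem_cat ?xU ?orbT //.
  by case: (core) c0 => //= y t _; rewrite mem_last.
Qed.

Lemma map_size_peel w r (ss : seq (seq nat)) (X : seq nat) : perm_eq (map size ss) X ->
  perm_eq (map size (map (fun l => rcons (map (addn w) l) (r l)) ss)) (map succn X).
Proof.
move=> p; rewrite -map_comp (eq_map (g := succn \o size)) => [|s /=]; last first.
  by rewrite size_rcons size_map.
by rewrite map_comp perm_map.
Qed.

Lemma hasZ_peel : has2 L A B -> 2 <= size B <= size A -> hasZ L (map succn A) (map succn B).
Proof.
move=> [core [LU [LV [h1 h2 h3 [M G]]]]] sAB.
have c0 : nonnil core by rewrite /nonnil h1.
have U0 := pos_nonnil h2 A0; have V0 := pos_nonnil h3 B0.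
have s3 : 3 <= size (cV (spider core LU LV)) <= size (cU (spider core LU LV)).
  by rewrite /= !size_map (size_perm_map h2) (size_perm_map h3); lia.
have [x1 x2 x3 x4] := peel_hyps G c0 U0 V0.
have := goodZ_perm (spider_peel c0 U0 V0) (goodZ_cpeel G s3 x1 x2 x3 x4) => G'.
set E := cE _ in G'; set w := size E in G'; pose r l := rank E (last 0 l).
exists (map (addn w) core), (map (fun l => rcons (map (addn w) l) (r l)) LU),
  (map (fun l => rcons (map (addn w) l) (r l)) LV).
by split; rewrite ?size_map ?map_size_peel //; exists w.
Qed.

Lemma has3_peel : hasZ L A B -> 2 <= size B <= size A -> has3 L (map succn A) (map succn B).
Proof.
move=> [core [LU [LV [h1 h2 h3 [s G]]]]] sAB.
have c0 : nonnil core by rewrite /nonnil h1.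
have U0 := pos_nonnil h2 A0; have V0 := pos_nonnil h3 B0.
have s3 : 3 <= size (cV (spider core LU LV)) <= size (cU (spider core LU LV)).
  by rewrite /= !size_map (size_perm_map h2) (size_perm_map h3); lia.
have [x1 x2 x3 x4] := peel_hyps (z_good2 G) c0 U0 V0.
have w1 : 1 < size (cE (spider core LU LV)).
  by rewrite /= size_cat !size_map (size_perm_map h2) (size_perm_map h3); lia.
have := good3_perm (spider_peel c0 U0 V0) (good3_cpeel G s3 w1 x1 x2 x3 x4) => G'.
set E := cE _ in G'; set w := size E in G'; pose r l := rank E (last 0 l).
exists (map (addn w) core), (map (fun l => rcons (map (addn w) l) (r l)) LU),
  (map (fun l => rcons (map (addn w) l) (r l)) LV).
by split; rewrite ?size_map ?map_size_peel //; exists w, w.+1, (s + w).+1.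
Qed.

End Operations.

(** * Parametrised labellings *)

(* Affine forms in natural parameters are lists of coefficients, the constant one first;
   they are evaluated on [1 :: n], where [n] lists the parameters. *)
Fixpoint ev (f n : seq nat) : nat :=
  if f is a :: f' then if n is x :: n' then a * x + ev f' n' else 0 else 0.

(** Missing coefficients count as zero. For natural parameters the coefficientwise order is also
    necessary, so the test loses nothing. *)
Fixpoint ale (f g : seq nat) : bool :=
  if f is a :: f' then if g is b :: g' then (a <= b) && ale f' g' else (a == 0) && ale f' [::]
  else true.

Fixpoint aadd (f g : seq nat) : seq nat :=
  match f, g with
  | a :: f', b :: g' => (a + b) :: aadd f' g'
  | [::], _ => g
  | _, [::] => f
  end.

Lemma ev_le f g n : ale f g -> ev f n <= ev g n.
Proof.
elim: f g n => // a f IHf [|b g] [|x n] //= /andP[ab fg].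
  by rewrite (eqP ab) mul0n add0n; apply: (IHf [::]).
by rewrite leq_add ?leq_mul2r ?ab ?orbT // IHf.
Qed.

Lemma ev_add f g n : ev (aadd f g) n = ev f n + ev g n.
Proof.
elim: f g n => // a f IHf [|b g] [|x n] //=; first by rewrite addn0.
by rewrite IHf mulnDl; lia.
Qed.

Definition cst k : seq nat := [:: k].
Definition par j k : seq nat := 0 :: nseq j 0 ++ [:: k].

Lemma ev_cst k n : ev (cst k) (1 :: n) = k.
Proof. by rewrite /= muln1; case: n => *; rewrite addn0. Qed.

Lemma ev_par j k n : ev (par j k) (1 :: n) = k * nth 0 n j.
Proof.
rewrite /= mul0n add0n; elim: j n => [|j IHj] [|x n] //=; rewrite ?muln0 ?mul0n ?add0n //.
  by case: n => *; rewrite addn0.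
Qed.

(* A piece is either an edge with an affine label or a zigzag of [2 * n_j + 1] edges whose
   labels increase ([true]) or decrease ([false]). *)
Definition piece : Type := (option (nat * bool) * (seq nat * seq nat))%type.

Definition pev (n : seq nat) (p : piece) : seq nat :=
  match p with
  | (None, (f, _)) => [:: ev f (1 :: n)]
  | (Some (j, up), (a, b)) =>
      let z := zig (2 * nth 0 n j).+1 (ev a (1 :: n)) (ev b (1 :: n)) in if up then z else rev z
  end.

Definition lft (p : piece) : seq nat :=
  match p with
  | (None, (f, _)) => f
  | (Some (j, up), (a, b)) => if up then a else aadd a (par j 1)
  end.

Definition rgt (p : piece) : seq nat :=
  match p with
  | (None, (f, _)) => f
  | (Some (j, up), (a, b)) => if up then aadd a (par j 1) else a
  end.

Definition plen (p : piece) : seq nat :=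
  if p.1 is Some (j, _) then aadd (cst 1) (par j 2) else cst 1.

Definition slen (ps : seq piece) : seq nat := foldr aadd [::] (map plen ps).
Definition sev (n : seq nat) (ps : seq piece) : seq nat := flatten (map (pev n) ps).

Lemma size_pev n p : size (pev n p) = ev (plen p) (1 :: n).
Proof.
case: p => [[[j up]|] [a b]]; rewrite /pev /plen; cbn [fst]; last by rewrite ev_cst.
rewrite ev_add ev_cst ev_par.
by case: up; rewrite ?size_rev size_zig; lia.
Qed.

Lemma size_sev n ps : size (sev n ps) = ev (slen ps) (1 :: n).
Proof.
by elim: ps => //= p ps IHps; rewrite /sev /slen /= size_cat ev_add size_pev -IHps.
Qed.

Lemma last_zigD a b n : last 0 (zig (2 * n).+1 a b) = a + n.
Proof.
rewrite [last _ _]/= last_zig; have -> : odd (2 * n) = false by lia.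
lia.
Qed.

Lemma pev_cons n p : exists x s, pev n p = x :: s /\ x = ev (lft p) (1 :: n) /\
  last x s = ev (rgt p) (1 :: n).
Proof.
case: p => [[[j up]|] [a b]]; last by exists (ev a (1 :: n)), [::].
have Hl := last_zigD (ev a (1 :: n)) (ev b (1 :: n)) (nth 0 n j).
case: up; rewrite /pev /lft /rgt ?ev_add ?ev_par mul1n.
  by eexists _, _; split; [reflexivity | split].
have := head_rev (zig (2 * nth 0 n j).+1 (ev a (1 :: n)) (ev b (1 :: n))) 0; rewrite Hl.
have := last_rev (zig (2 * nth 0 n j).+1 (ev a (1 :: n)) (ev b (1 :: n))) 0.
case E: (rev _) => [|x s]; first by move/(congr1 size): E; rewrite size_rev size_zig.
by move=> /= H1 H2; exists x, s.
Qed.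

Lemma head_sev n p ps : head 0 (sev n (p :: ps)) = ev (lft p) (1 :: n).
Proof. by rewrite /sev /=; have [x [s [-> [-> _]]]] := pev_cons n p. Qed.

Lemma last_sev n p ps : last 0 (sev n (p :: ps)) = ev (rgt (last p ps)) (1 :: n).
Proof.
elim: ps p => [|q ps IHps] p; rewrite /sev /=.
  by have [x [s [-> [_ /= <-]]]] := pev_cons n p; rewrite cats0.
by rewrite last_cat -[last q ps]/(last q ps) -IHps /sev /=; have [x [s [-> _]]] := pev_cons n q.
Qed.

(* Upper ends of the intervals are excluded. *)
Definition litem (p : piece) : seq (seq nat * seq nat) :=
  match p with
  | (None, (f, _)) => [:: (f, aadd f (cst 1))]
  | (Some (j, _), (a, b)) =>
      [:: (a, aadd a (aadd (cst 1) (par j 1))); (b, aadd b (par j 1))]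
  end.

Definition range (n : seq nat) (i : seq nat * seq nat) : seq nat :=
  iota (ev i.1 (1 :: n)) (ev i.2 (1 :: n) - ev i.1 (1 :: n)).

Lemma perm_zig n a b : perm_eq (zig n a b) (iota a (uphalf n) ++ iota b n./2).
Proof.
elim: n a b => // n IHn a b; rewrite /= perm_cons.
by apply: perm_trans (IHn b a.+1) _; rewrite perm_catC.
Qed.

Lemma perm_pev n p : perm_eq (pev n p) (flatten (map (range n) (litem p))).
Proof.
case: p => [[[j up]|] [a b]]; last first.
  by rewrite /pev /litem /map /range; cbn [fst snd]; rewrite ev_add ev_cst addKn.
have E1 : range n (a, aadd a (aadd (cst 1) (par j 1))) = iota (ev a (1 :: n)) (nth 0 n j).+1.
  by rewrite /range; cbn [fst snd]; rewrite !ev_add ev_cst ev_par addKn mul1n.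
have E2 : range n (b, aadd b (par j 1)) = iota (ev b (1 :: n)) (nth 0 n j).
  by rewrite /range; cbn [fst snd]; rewrite !ev_add ev_par addKn mul1n.
have -> : flatten (map (range n) (litem (Some (j, up), (a, b)))) =
    iota (ev a (1 :: n)) (nth 0 n j).+1 ++ iota (ev b (1 :: n)) (nth 0 n j).
  by rewrite -E1 -E2 /litem /map /flatten /foldr cats0.
have := perm_zig (2 * nth 0 n j).+1 (ev a (1 :: n)) (ev b (1 :: n)).
have -> : uphalf (2 * nth 0 n j).+1 = (nth 0 n j).+1 by lia.
have -> : (2 * nth 0 n j).+1./2 = nth 0 n j by lia.
by rewrite /pev; case: up; rewrite ?perm_rev.
Qed.

Lemma perm_sev n ps : perm_eq (sev n ps) (flatten (map (range n) (flatten (map litem ps)))).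
Proof.
elim: ps => //= p ps IHps; rewrite map_cat flatten_cat.
by apply: perm_cat (perm_pev n p) IHps.
Qed.

Definition sep (i i' : seq nat * seq nat) : bool := ale i.2 i'.1 || ale i'.2 i.1.

Lemma uniq_ranges n (r : rel (seq nat * seq nat)) l : subrel r sep -> pairwise r l ->
  uniq (flatten (map (range n) l)).
Proof.
move=> rs; elim: l => //= i l IHl /andP[/allP il pl]; rewrite cat_uniq iota_uniq IHl // andbT /=.
apply/hasPn => x /flattenP[_ /mapP[i' il' ->]]; rewrite !mem_iota => Hx.
by have /orP[/ev_le|/ev_le] := rs _ _ (il i' il'); move/(_ (1 :: n)); lia.
Qed.

(* A vertex of degree two: [None] for a pair of consecutive pieces, [Some j] for the inner
   vertices of a zigzag. *)
Definition ditem : Type := (option nat * (seq nat * seq nat))%type.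

Definition dlo (i : ditem) : seq nat := aadd i.2.1 i.2.2.
Definition dhi (i : ditem) : seq nat :=
  aadd (dlo i) (if i.1 is Some j then par j 2 else cst 1).
Definition ditv (i : ditem) := (dlo i, dhi i).

Definition dmem (n : seq nat) (i : ditem) (d : nat * nat) : Prop :=
  let a := ev i.2.1 (1 :: n) in let b := ev i.2.2 (1 :: n) in
  if i.1 is Some j then
    ((a <= d.1 <= a + nth 0 n j) && (b <= d.2 < b + nth 0 n j)) ||
    ((a <= d.2 <= a + nth 0 n j) && (b <= d.1 < b + nth 0 n j)) /\
    a + b <= psum d < a + b + 2 * nth 0 n j
  else d = (a, b).

Definition pitem (p : piece) : seq ditem := if p.1 is Some (j, _) then [:: (Some j, p.2)] else [::].

Fixpoint sitems (ps : seq piece) : seq ditem :=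
  if ps is p :: ps' then
    pitem p ++ (if ps' is q :: _ then [:: (None, (rgt p, lft q))] else [::]) ++ sitems ps'
  else [::].

Lemma adjs_pev n p : perm_eq (map psum (adjs (pev n p))) (flatten (map (range n) (map ditv (pitem p)))) /\
  (forall d : nat * nat, d \in adjs (pev n p) -> exists2 i, i \in pitem p & dmem n i d).
Proof.
case: p => [[[j up]|] [a b]]; last by [].
have E : flatten (map (range n) (map ditv (pitem (Some (j, up), (a, b))))) =
    iota (ev a (1 :: n) + ev b (1 :: n)) (2 * nth 0 n j).
  rewrite /pitem; cbn [fst snd]; rewrite /map /flatten /foldr cats0.
  by rewrite /range /ditv /dhi /dlo; cbn [fst snd]; rewrite !ev_add ev_par addKn.
rewrite E {E} /pev; set z := zig _ _ _.
have zs : map psum (adjs z) = iota (ev a (1 :: n) + ev b (1 :: n)) (2 * nth 0 n j).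
  by rewrite zig_sums.
have zm (d : nat * nat) : d \in adjs z -> dmem n (Some j, (a, b)) d.
  move=> dz; have := mem_adjs_zig dz; have := map_f psum dz; rewrite zs mem_iota /dmem /=; lia.
case: up; split; rewrite ?adjs_rev_sums ?perm_rev ?zs //.
  by move=> d dz; exists (Some j, (a, b)); [apply: mem_head | apply: zm].
move=> d /mem_adjs_rev /zm Hd; exists (Some j, (a, b)); first exact: mem_head.
by move: Hd; rewrite /dmem /swap /psum /=; lia.
Qed.

Lemma adjs_sev n ps :
  perm_eq (map psum (adjs (sev n ps))) (flatten (map (range n) (map ditv (sitems ps)))) /\
  (forall d : nat * nat, d \in adjs (sev n ps) -> exists2 i, i \in sitems ps & dmem n i d).
Proof.
elim: ps => [|p ps [IH1 IH2]] //; have [P1 P2] := adjs_pev n p.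
case: ps IH1 IH2 => [|q ps] IH1 IH2; first by rewrite /sev /= !cats0.
have [x [s [Ep [_ lp]]]] := pev_cons n p; have [y [t [Eq [hq _]]]] := pev_cons n q.
have E : adjs (sev n (p :: q :: ps)) =
    adjs (pev n p) ++ (ev (rgt p) (1 :: n), ev (lft q) (1 :: n)) :: adjs (sev n (q :: ps)).
  by rewrite /sev /= Ep Eq -[_ ++ (y :: t) ++ _]/((x :: s) ++ y :: (t ++ _)) adjs_cat lp hq.
have -> : sitems (p :: q :: ps) = pitem p ++ (None, (rgt p, lft q)) :: sitems (q :: ps) by [].
rewrite E; split.
  rewrite !map_cat flatten_cat; apply: perm_cat => //; rewrite !map_cons [flatten _]/=.
  have -> : range n (ditv (None, (rgt p, lft q))) =
      [:: psum (ev (rgt p) (1 :: n), ev (lft q) (1 :: n))].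
    by rewrite /range /ditv /dhi /dlo; cbn [fst snd]; rewrite !ev_add ev_cst addKn.
  by rewrite perm_cons.
move=> d; rewrite mem_cat inE => /or3P[/P2[i ip Hi]|/eqP->|/IH2[i ip Hi]].
- by exists i => //; rewrite mem_cat ip.
- by exists (None, (rgt p, lft q)) => //; rewrite mem_cat inE eqxx orbT.
- by exists i => //; rewrite mem_cat inE ip !orbT.
Qed.

Definition asucc (f : seq nat) : seq nat := aadd f (cst 1).

Lemma ev_succ f n : ev (asucc f) (1 :: n) = (ev f (1 :: n)).+1.
Proof. by rewrite ev_add ev_cst addn1. Qed.

(* The comparison of [x] with [t] does not depend on the parameters. *)
Definition dec (t x : seq nat) : bool := ale t x || ale (asucc x) t.

Lemma dec_ev t x n : dec t x -> (ev t (1 :: n) <= ev x (1 :: n)) = ale t x.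
Proof.
rewrite /dec; case E: (ale t x) => /=; first by move=> _; apply: ev_le.
by move/ev_le => /(_ (1 :: n)); rewrite ev_succ; lia.
Qed.

Definition evs n (l : seq (seq nat)) : seq nat := [seq ev f (1 :: n) | f <- l].

Lemma count_dec t n l : all (dec t) l -> count (leq (ev t (1 :: n))) (evs n l) = count (ale t) l.
Proof.
by move=> /allP dl; rewrite count_map; apply: eq_in_count => x /dl Hx /=; apply: dec_ev.
Qed.

Definition asum (l : seq (seq nat)) : seq nat := foldr aadd [::] l.

Lemma sumn_evs n l : sumn (evs n l) = ev (asum l) (1 :: n).
Proof. by elim: l => //= f l IHl; rewrite ev_add IHl. Qed.

Definition p0 : piece := (None, ([::], [::])).
Definition hd (ps : seq piece) : seq nat := lft (head p0 ps).
Definition tl (ps : seq piece) : seq nat := rgt (last p0 ps).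

(** * Checking the invariants on a parametrised labelling *)

Section Check.
Variables (s s1 c2 : seq nat) (core l1 l2 l3 l4 : seq piece).

Definition segs := [:: core; l1; l2; l3; l4].
Definition litems := flatten (map litem (flatten segs)).
Definition ditems := flatten (map sitems segs).
Definition total := slen (flatten segs).
Definition hubU := [:: hd core; hd l1; hd l2].
Definition hubV := [:: tl core; hd l3; hd l4].
Definition s' := asucc s.

(** The value of [cls] on the item. A zigzag counts 1 because [dok] makes it alternate across the
    threshold. *)
Definition wt (i : ditem) : nat := if i.1 is Some _ then 1 else ale s' i.2.1 + ale s' i.2.2.

Definition dok (i : ditem) : bool :=
  let a := i.2.1 in let b := i.2.2 in
  [&& ale (cst 1) a, ale (cst 1) b &
  if i.1 is Some j then
    (ale (asucc (aadd a (par j 1))) s' && ale s' b) || (ale s' a && ale (aadd b (par j 1)) s')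
  else [&& dec s' a, dec s' b & 0 < wt i]].

(** Bundling the weights with the intervals lets one pairwise test yield both distinct sums and
    [g_cls]. *)
Definition below (w : ditem -> nat) (i i' : ditem) : bool := ale (dhi i) (dlo i') && (w i <= w i').
Definition apart (w : ditem -> nat) (i i' : ditem) : bool := below w i i' || below w i' i.

Definition checkZ : bool :=
  [&& all (fun ps => ps != [::]) segs,
      pairwise sep litems,
      all (fun i => ale (cst 1) i.1 && ale i.2 (asucc total)) litems,
      ale s total &
  [&& all dok ditems,
      pairwise (apart wt) ditems,
      all (fun ps => ale (asucc (tl ps)) s') [:: l1; l2; l3; l4],
      all (fun i => ale (dhi i) (asum hubV)) ditems &
  [&& ale s' (asum hubV), ale (asucc (asum hubV)) (asum hubU),
      all (dec s') hubU, all (dec s') hubV,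
      count (ale s') hubV <= (count (ale s') hubU).+1 & 0 < count (ale s') hubV]]].

Definition wt3 (i : ditem) : nat :=
  if wt i == 2 then 2 + ale c2 i.2.1 + ale c2 i.2.2 else wt i.

Definition dok3 (i : ditem) : bool :=
  let a := i.2.1 in let b := i.2.2 in
  if i.1 is Some j then
    [&& ale s' b, ale (asucc (aadd a (par j 1))) s1 & ale (aadd b (par j 1)) c2] ||
    [&& ale s' a, ale (asucc (aadd a (par j 1))) c2 & ale (aadd b (par j 1)) s1]
  else if wt i == 2 then [&& dec c2 a, dec c2 b & ale c2 a || ale c2 b]
  else let: (x, y) := if ale s' a then (b, a) else (a, b) in
    (ale (asucc x) s1 && ale (asucc y) c2) ||
    [&& ale s1 x, ale c2 y & ale (aadd x y) (aadd c2 s)].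

Definition check3 : bool :=
  [&& checkZ, ale (cst 1) s1, ale s1 s', ale s' c2 &
  [&& ale c2 (asucc total), all dok3 ditems, pairwise (apart wt3) ditems,
      ale (asucc (aadd c2 s)) (asum hubV) &
  [&& 1 < count (ale s') hubV, all (dec s1) hubU, all (dec s1) hubV,
      all (dec c2) hubU, all (dec c2) hubV &
  [&& count (ale s1) hubV <= (count (ale s1) hubU).+1,
      count (ale c2) hubV <= (count (ale c2) hubU).+1 & ale (cst 2) s]]]].

Section Sound.
Variable n : seq nat.
Notation e := (fun f => ev f (1 :: n)).
Let c := spider (sev n core) [:: sev n l1; sev n l2] [:: sev n l3; sev n l4].

Lemma cL_sound : cL c = sev n (flatten segs).
Proof. by rewrite /c /= /sev !map_cat !flatten_cat !cats0 -!catA. Qed.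

Lemma cD_sums : perm_eq (map psum (cD c)) (flatten (map (range n) (map ditv ditems))).
Proof.
have H ps := proj1 (adjs_sev n ps).
rewrite /c /ditems /= !cats0 !map_cat !flatten_cat -!catA.
by do 4 (apply: perm_cat; first exact: H); apply: H.
Qed.

Lemma cD_mem (d : nat * nat) : d \in cD c -> exists2 i, i \in ditems & dmem n i d.
Proof.
have H ps := proj2 (adjs_sev n ps) d.
rewrite /c /ditems /= !cats0 !mem_cat -!orbA => /or4P[| | |/orP[]] /H[i il Hi]; exists i => //;
  by rewrite !mem_cat il ?orbT.
Qed.

Lemma dmem_sum i d : dmem n i d -> e (dlo i) <= psum d < e (dhi i).
Proof.
case: i => [[j|] [a b]]; rewrite /dmem /dhi /dlo; cbn [fst snd]; rewrite !ev_add ?ev_par ?ev_cst.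
  by case.
by move=> ->; rewrite /psum /=; lia.
Qed.

Lemma dmem_cls i d : dok i -> dmem n i d -> cls (e s) d = wt i /\ (0 < d.1) && (0 < d.2).
Proof.
case: i => [[j|] [a b]]; rewrite /dok /dmem /wt; cbn [fst snd] => /and3P[/(ev_le (1 :: n)) a0 /(ev_le (1 :: n)) b0].
  move: a0 b0; rewrite !ev_cst => a0 b0.
  case/orP => /andP[/(ev_le (1 :: n)) H1 /(ev_le (1 :: n)) H2];
  move: H1 H2; rewrite !ev_succ !ev_add !ev_par ?ev_succ /cls => H1 H2 [H3 _]; lia.
move: a0 b0; rewrite !ev_cst => a0 b0.
case/and3P => da db _ ->; rewrite /cls /= -(dec_ev n da) -(dec_ev n db) !ev_succ; lia.
Qed.

Lemma apart_sum w i i' d d' : i \in ditems -> i' \in ditems -> pairwise (apart w) ditems ->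
  dmem n i d -> dmem n i' d' -> w i < w i' -> psum d < psum d'.
Proof.
move=> il il' pw Hd Hd' lt.
have ii' : apart w i i' || apart w i' i || (i == i').
  have := pw; move/(pairwiseP i) => P.
  have := P (index i ditems) (index i' ditems); have := P (index i' ditems) (index i ditems).
  rewrite !inE !index_mem !nth_index // => P1 P2.
  case: (ltngtP (index i ditems) (index i' ditems)) => H.
  - by rewrite (P2 il il' H).
  - by rewrite (P1 il' il H) orbT.
  - suff -> : i = i' by rewrite eqxx !orbT.
    by rewrite -(nth_index i il) H nth_index.
have := dmem_sum Hd; have := dmem_sum Hd'.
have: below w i i' || below w i' i || (i == i').
  by case/orP: ii' => [/orP[|]|->]; rewrite ?orbT // /apart => /orP[]->; rewrite ?orbT.
case/orP => [/orP[] /andP[/(ev_le (1 :: n)) H Hw]|/eqP E]; try lia.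
by move: lt; rewrite E ltnn.
Qed.

Lemma hubU_sound : all (fun ps => ps != [::]) segs -> cU c = evs n hubU.
Proof.
move=> /and5P[h0 h1 h2 _ _]; rewrite /c /evs /= /hd.
by case: core h0 => // p ? _; case: l1 h1 => // p1 ? _; case: l2 h2 => // p2 ? _; rewrite !head_sev.
Qed.

Lemma hubV_sound : all (fun ps => ps != [::]) segs -> cV c = evs n hubV.
Proof.
move=> /and5P[h0 _ _ h1]; rewrite andbT => h2; rewrite /c /evs /= /hd /tl.
case: core h0 => // p ? _; case: l3 h1 => // p1 ? _; case: l4 h2 => // p2 ? _.
by rewrite !head_sev last_sev.
Qed.

Lemma checkZ_sound : checkZ -> goodZ (e s) c.
Proof.
case/and5P => nn pwl bl sm /and5P[dk pwd lf dV /and5P[sV VU dU dV' /andP[kap kV]]].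
have s'E : e s' = (e s).+1 by rewrite ev_succ.
have cntE l : all (dec s') l -> count (ltn (e s)) (evs n l) = count (ale s') l.
  by move/(count_dec n); rewrite s'E.
have szL : size (cL c) = e total by rewrite cL_sound size_sev.
have Vs : sumn (cV c) = e (asum hubV) by rewrite hubV_sound // sumn_evs.
have Us : sumn (cU c) = e (asum hubU) by rewrite hubU_sound // sumn_evs.
have cD_cls (d : nat * nat) : d \in cD c -> exists i, [/\ i \in ditems, dmem n i d,
    cls (e s) d = wt i, (0 < d.1) && (0 < d.2) & 0 < wt i].
  case/cD_mem => i il Hi; exists i; have := allP dk i il => Hk.
  have [-> ->] := dmem_cls Hk Hi; split => //.
  by move: Hk; rewrite /dok /wt; case: (i.1) => [j|]; case/and3P => // _ _ /and3P[].
have Epos : e s < sumn (cV c) by rewrite Vs -ltnS -s'E ltnS; exact: ev_le.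
split; last 2 first.
- by move=> d /cD_cls[i [_ _ -> _]].
- by rewrite hubV_sound // cntE.
split.
- rewrite cL_sound (perm_uniq (perm_sev _ _)).
  by apply: (@uniq_ranges n sep).
- move=> x; rewrite szL cL_sound (perm_mem (perm_sev _ _)) => /flattenP[_ /mapP[i il ->]].
  rewrite mem_iota; have /andP[/(ev_le (1 :: n)) H1 /(ev_le (1 :: n))] := allP bl i il.
  by rewrite ev_succ; move: H1; rewrite ev_cst; clear; lia.
- by rewrite szL; apply: ev_le.
- by move=> d /cD_cls[i []].
- rewrite (perm_uniq cD_sums).
  apply: (@uniq_ranges n sep) => //.
  rewrite pairwise_map; apply: sub_pairwise pwd => i i' /orP[] /andP[H _]; rewrite /sep /= H ?orbT //.
- move=> x /=; rewrite !inE => Hx.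
  have lfE ps : ps != [::] -> ale (asucc (tl ps)) s' -> last 0 (sev n ps) <= e s.
    case: ps => // p ps _ /(ev_le (1 :: n)).
    by rewrite ev_succ s'E last_sev /tl.
  move: nn lf => /and5P[_ h1 h2 h3]; rewrite andbT => h4 /and5P[f1 f2 f3 f4 _].
  by case/or4P: Hx => /eqP->; apply: lfE.
- move=> d /cD_cls[i [_ _ Hc Hp Hw]]; move: Hw Hp; rewrite -Hc /cls /psum; clear; lia.
- move=> d d' /cD_cls[i [il Hi -> _ _]] /cD_cls[i' [il' Hi' -> _ _]].
  exact: apart_sum pwd Hi Hi'.
- move=> d /cD_cls[i [il Hi _ _ _]]; rewrite Vs.
  by have := ev_le (1 :: n) (allP dV i il); have := dmem_sum Hi; clear; lia.
- exact: Epos.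
- by rewrite Vs Us -ev_succ; apply: ev_le.
- by rewrite hubV_sound // hubU_sound // !cntE.
Qed.

Lemma check3_sound : check3 -> good3 (e s) (e s1) (e c2) c.
Proof.
case/and5P => cZ s10 s1s sc2 /and5P[c2m dk pw Vb /and5P[kV d1U d1V d2U /and4P[d2V k1 k2 s2]]].
have GZ := checkZ_sound cZ.
have dkZ : all dok ditems by case/and5P: cZ => _ _ _ _ /and5P[].
have nn : all (fun ps => ps != [::]) segs by case/and5P: cZ.
have [dU dV] : all (dec s') hubU /\ all (dec s') hubV.
  by case/and5P: cZ => _ _ _ _ /and5P[_ _ _ _ /and5P[_ _ ? ? _]].
have s'E : e s' = (e s).+1 by rewrite ev_succ.
have szL : size (cL c) = e total by rewrite cL_sound size_sev.
have Vs : sumn (cV c) = e (asum hubV) by rewrite hubV_sound // sumn_evs.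
move: s10 s1s sc2 c2m Vb s2 => /(ev_le (1 :: n)) s10 /(ev_le (1 :: n)) s1s /(ev_le (1 :: n)) sc2.
move=> /(ev_le (1 :: n)) c2m /(ev_le (1 :: n)) Vb /(ev_le (1 :: n)) s2.
move: s10 s1s sc2 c2m Vb s2; rewrite !ev_cst !ev_succ ev_add => s10 s1s sc2 c2m Vb s2.
have cD_cls (d : nat * nat) : d \in cD c -> exists i, [/\ i \in ditems, dmem n i d,
    cls (e s) d = wt i & dok3 i && dok i].
  case/cD_mem => i il Hi; exists i; have [-> _] := dmem_cls (allP dkZ i il) Hi.
  by rewrite (allP dk i il) (allP dkZ i il).
have key (d : nat * nat) : d \in cD c ->
    [|| (minn d.1 d.2 < e s1) && (e s < maxn d.1 d.2 < e c2),
        (e s1 <= minn d.1 d.2 <= e s) && (e c2 <= maxn d.1 d.2) |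
        (e s < minn d.1 d.2) && (e c2 <= maxn d.1 d.2)] /\
    (cls (e s) d = 1 -> psum d <= e c2 + e s).
  clear pw kV d1U d1V d2U d2V k1 k2 GZ dkZ nn dU dV cZ dk szL Vs c2m Vb s2.
  case/cD_cls => -[[j|] [a b]] [il Hi]; rewrite /dok3 /dok; cbn [fst snd].
    move: Hi; rewrite /dmem; cbn [fst snd] => -[Hd _] _.
    case/andP => /orP[] /and3P[/(ev_le (1 :: n)) H1 /(ev_le (1 :: n)) H2 /(ev_le (1 :: n)) H3] _;
      move: H1 H2 H3; rewrite !ev_succ !ev_add !ev_par => H1 H2 H3; rewrite /psum; lia.
  move: Hi; rewrite /dmem; cbn [fst snd] => -> clE /andP[H1 /and3P[_ _ /and3P[da db w0]]].
  move: clE w0 H1; rewrite /wt /cls /psum; cbn [fst snd]; rewrite -(dec_ev n da) -(dec_ev n db) s'E.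
  case: ifP => Hw clE w0.
    case/and3P => da2 db2; rewrite -(dec_ev n da2) -(dec_ev n db2); lia.
  case: (ltnP (e s) (e a)) => Ha.
    case/orP => [/andP[/(ev_le (1 :: n)) H1 /(ev_le (1 :: n)) H2]|
                 /and3P[/(ev_le (1 :: n)) H1 /(ev_le (1 :: n)) H2 /(ev_le (1 :: n)) H3]].
      by move: H1 H2; rewrite !ev_succ; lia.
    by move: H3; rewrite !ev_add; lia.
  case/orP => [/andP[/(ev_le (1 :: n)) H1 /(ev_le (1 :: n)) H2]|
               /and3P[/(ev_le (1 :: n)) H1 /(ev_le (1 :: n)) H2 /(ev_le (1 :: n)) H3]].
    by move: H1 H2; rewrite !ev_succ; lia.
  by move: H3; rewrite !ev_add; lia.
split => //.
- by move: s10 s1s; clear; lia.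
- by rewrite szL; move: sc2 c2m; clear; lia.
- by move=> d /key[].
- by move=> d /key[].
- move=> d d' /cD_cls[i [il Hi -> Ki]] /cD_cls[i' [il' Hi' -> Ki']] E E' Hc.
  apply: (apart_sum il il' pw Hi Hi'); rewrite /wt3 E E' eqxx /=.
  have c2E k q : wt k = 2 -> dok3 k && dok k -> dmem n k q ->
      cls (e c2).-1 q = ale c2 k.2.1 + ale c2 k.2.2.
    case: k => [[j|] [a b]]; rewrite /wt /dok3; cbn [fst snd] => // Ek.
    rewrite /wt; cbn [fst snd]; rewrite Ek eqxx => /andP[/and3P[da db _] _].
    rewrite /dmem; cbn [fst snd] => ->; rewrite /cls; cbn [fst snd].
    by rewrite -(dec_ev n da) -(dec_ev n db); move: sc2; clear; lia.
  by rewrite -!addnA ltn_add2l -(c2E i d) // -(c2E i' d').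
- by rewrite Vs; move: Vb; clear; lia.
- have cntE : count (ltn (e s)) (evs n hubV) = count (ale s') hubV.
    by have := count_dec n dV; rewrite s'E.
  by rewrite hubV_sound // cntE.
- by rewrite hubV_sound // hubU_sound // !count_dec.
- by rewrite hubV_sound // hubU_sound // !count_dec.
Qed.

End Sound.
End Check.

(** * Hubs of degree three *)

(* An entry lists the labels of the core, of the two legs of [u] and of the two legs of [v],
   then the largest label [s] that counts as small, then for each of the five paths how it is
   lengthened. [Y i o t] means that edge [i] is replaced by a zigzag of odd length: its labels
   on one side of [s] start at that of edge [i] and are increasing for [o = 0], decreasing for
   [o = 1]; those on the other side start at the value [t]. *)
Definition entry : Type := (seq (seq nat) * nat * seq (option (nat * nat * nat)))%type.
Local Notation N := (@None (nat * nat * nat)).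
Local Notation Y i o t := (Some (i, o, t)) (only parsing).

(* The entries of the two tables were found by computer search. *)
Definition tableZ : seq entry := [::
  ([:: [:: 7]; [:: 4]; [:: 6; 2]; [:: 3]; [:: 5; 1]], 4, [:: Y 0 0 4; N; Y 1 1 6; Y 0 1 7; Y 1 1 5]);
  ([:: [:: 6; 8]; [:: 4]; [:: 7; 3]; [:: 2]; [:: 5; 1]], 4, [:: Y 0 1 2; N; Y 1 0 8; Y 0 0 7; Y 1 1 5]);
  ([:: [:: 7]; [:: 4]; [:: 8; 3]; [:: 6; 2]; [:: 5; 1]], 4, [:: Y 0 0 3; N; Y 1 0 9; Y 0 0 2; Y 0 0 1]);
  ([:: [:: 7]; [:: 6; 2]; [:: 5; 1]; [:: 4]; [:: 3]], 4, [:: Y 0 0 4; Y 1 1 6; Y 1 1 5; N; Y 0 1 7]);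
  ([:: [:: 7]; [:: 8; 3]; [:: 5; 1]; [:: 4]; [:: 6; 2]], 4, [:: Y 0 0 3; Y 1 0 9; Y 1 1 5; N; Y 1 1 6]);
  ([:: [:: 9; 4]; [:: 5]; [:: 8; 3]; [:: 7; 2]; [:: 6; 1]], 5, [:: Y 1 0 10; N; Y 0 0 3; Y 1 1 7; Y 1 1 6]);
  ([:: [:: 6; 8]; [:: 5; 1]; [:: 7; 2]; [:: 3]; [:: 4]], 4, [:: Y 0 1 2; Y 1 1 5; Y 0 1 3; N; Y 0 1 8]);
  ([:: [:: 9; 6]; [:: 8; 3]; [:: 5; 1]; [:: 4]; [:: 7; 2]], 4, [:: Y 1 1 2; Y 0 1 4; Y 1 1 5; N; Y 0 1 3]);
  ([:: [:: 8]; [:: 5; 1]; [:: 9; 7; 3]; [:: 4]; [:: 6; 2]], 4, [:: Y 0 0 4; Y 1 1 5; Y 1 0 3; N; Y 1 1 6]);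
  ([:: [:: 8; 5]; [:: 2]; [:: 7; 3]; [:: 4]; [:: 6; 1]], 4, [:: Y 1 1 1; Y 0 0 7; Y 1 0 8; N; Y 0 1 2]);
  ([:: [:: 8]; [:: 4]; [:: 9; 7; 3]; [:: 5; 1]; [:: 6; 2]], 4, [:: Y 0 0 4; N; Y 1 0 3; Y 0 0 1; Y 0 0 2]);
  ([:: [:: 8; 3]; [:: 5]; [:: 4]; [:: 6; 1]; [:: 7; 2]], 5, [:: Y 1 0 9; N; N; Y 0 0 1; Y 0 0 2]);
  ([:: [:: 9; 3]; [:: 4]; [:: 6; 10; 5]; [:: 8; 2]; [:: 7; 1]], 5, [:: Y 1 0 10; N; Y 0 1 1; Y 1 0 9; Y 1 0 8]);
  ([:: [:: 6]; [:: 4]; [:: 3]; [:: 1]; [:: 5; 2]], 4, [:: Y 0 0 3; N; N; N; Y 0 0 1]);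
  ([:: [:: 8]; [:: 5]; [:: 4]; [:: 6; 1]; [:: 2; 7; 3]], 5, [:: Y 0 0 4; N; N; Y 0 0 1; Y 1 0 3]);
  ([:: [:: 6]; [:: 3]; [:: 5; 1]; [:: 2]; [:: 4]], 4, [:: Y 0 0 3; N; Y 1 0 6; N; N]);
  ([:: [:: 8]; [:: 5]; [:: 6; 1]; [:: 4]; [:: 2; 7; 3]], 5, [:: Y 0 0 4; N; Y 1 1 6; N; Y 1 0 3]);
  ([:: [:: 8]; [:: 5]; [:: 9; 4]; [:: 3; 7; 2]; [:: 10; 6; 1]], 5, [:: Y 0 1 4; N; Y 0 1 5; Y 2 1 7; Y 2 1 6]);
  ([:: [:: 7]; [:: 4]; [:: 8; 6; 2]; [:: 3]; [:: 5; 1]], 4, [:: Y 0 0 4; N; Y 1 0 2; N; Y 1 1 5]);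
  ([:: [:: 9]; [:: 2]; [:: 10; 8; 5]; [:: 6; 1]; [:: 4; 7; 3]], 5, [:: Y 0 0 6; N; Y 1 0 5; Y 1 1 6; Y 1 1 4]);
  ([:: [:: 7]; [:: 6; 2]; [:: 8; 5; 1]; [:: 3]; [:: 4]], 4, [:: Y 0 1 3; Y 1 1 6; Y 2 1 5; N; N]);
  ([:: [:: 8]; [:: 6; 3]; [:: 9; 7; 4]; [:: 1]; [:: 10; 5; 2]], 4, [:: Y 0 0 5; Y 0 0 3; Y 1 0 4; N; Y 2 1 5]);
  ([:: [:: 8]; [:: 3; 9; 4]; [:: 10; 7; 2]; [:: 5]; [:: 6; 1]], 5, [:: Y 0 0 3; Y 1 0 4; Y 2 1 7; N; Y 1 1 6]);
  ([:: [:: 7; 3]; [:: 5]; [:: 4]; [:: 2]; [:: 6; 1]], 5, [:: Y 0 0 2; N; N; N; Y 1 1 6]);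
  ([:: [:: 9; 6]; [:: 5]; [:: 3]; [:: 8; 4]; [:: 2; 7; 1]], 5, [:: Y 1 1 1; N; N; Y 1 1 8; Y 1 1 2]);
  ([:: [:: 5; 7]; [:: 3]; [:: 6; 1]; [:: 4]; [:: 2]], 5, [:: Y 1 1 2; N; Y 1 1 6; N; N]);
  ([:: [:: 8; 4]; [:: 5]; [:: 7; 2]; [:: 3]; [:: 9; 6; 1]], 5, [:: Y 1 0 9; N; Y 1 0 8; N; Y 1 1 2]);
  ([:: [:: 11; 8]; [:: 4]; [:: 7; 2]; [:: 10; 6; 1]; [:: 3; 9; 5]], 5, [:: Y 1 1 3; N; Y 1 1 7; Y 2 1 6; Y 0 0 9]);
  ([:: [:: 7; 9]; [:: 3]; [:: 8; 5; 1]; [:: 2]; [:: 6; 4]], 4, [:: Y 0 1 5; N; Y 1 1 3; N; Y 1 1 6]);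
  ([:: [:: 8; 4]; [:: 3]; [:: 11; 7; 2]; [:: 6; 1]; [:: 10; 9; 5]], 5, [:: Y 0 0 3; N; Y 1 0 2; Y 1 1 6; Y 2 0 10]);
  ([:: [:: 5; 9]; [:: 6; 1]; [:: 7; 8; 2]; [:: 4]; [:: 3]], 4, [:: Y 0 1 1; Y 0 1 2; Y 1 1 4; N; N]);
  ([:: [:: 5; 11]; [:: 7; 1]; [:: 10; 8; 2]; [:: 4]; [:: 6; 9; 3]], 4, [:: Y 0 0 1; Y 0 1 2; Y 1 1 3; N; Y 1 1 4]);
  ([:: [:: 10; 6]; [:: 1; 7; 2]; [:: 11; 8; 3]; [:: 5]; [:: 9; 4]], 5, [:: Y 0 0 5; Y 0 0 7; Y 2 1 8; N; Y 0 0 4]);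
  ([:: [:: 5]; [:: 4]; [:: 2]; [:: 3]; [:: 1]], 4, [:: Y 0 0 2; N; N; N; N]);
  ([:: [:: 7]; [:: 5]; [:: 4]; [:: 3]; [:: 2; 6; 1]], 5, [:: Y 0 0 3; N; N; N; Y 2 1 6]);
  ([:: [:: 8]; [:: 5]; [:: 4]; [:: 7; 2]; [:: 1; 6; 9; 3]], 5, [:: Y 0 0 3; N; N; N; Y 0 0 6]);
  ([:: [:: 8]; [:: 5]; [:: 4]; [:: 6; 9; 3]; [:: 2; 7; 1]], 5, [:: Y 0 0 3; N; N; Y 0 0 1; Y 0 1 8]);
  ([:: [:: 10]; [:: 5]; [:: 6]; [:: 1; 7; 11; 4]; [:: 9; 3; 8; 2]], 6, [:: Y 0 0 4; N; N; Y 1 0 2; Y 1 1 9]);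
  ([:: [:: 6]; [:: 2]; [:: 7; 5; 1]; [:: 4]; [:: 3]], 4, [:: Y 0 1 3; N; Y 1 1 2; N; N]);
  ([:: [:: 7]; [:: 4]; [:: 9; 6; 3]; [:: 2]; [:: 8; 5; 1]], 4, [:: Y 0 0 4; N; Y 2 1 6; N; Y 2 1 5]);
  ([:: [:: 9]; [:: 5]; [:: 11; 6; 1]; [:: 10; 8; 4]; [:: 2; 7; 3]], 5, [:: Y 0 1 5; N; Y 1 1 2; Y 2 1 8; Y 0 0 7]);
  ([:: [:: 7]; [:: 9; 6; 1]; [:: 3; 8; 2]; [:: 5]; [:: 4]], 5, [:: Y 0 0 2; Y 2 1 6; Y 0 1 9; N; N]);
  ([:: [:: 8]; [:: 10; 6; 1]; [:: 4; 9; 5]; [:: 2]; [:: 11; 7; 3]], 5, [:: Y 0 0 4; Y 2 1 6; Y 1 0 5; N; Y 2 1 7]);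
  ([:: [:: 2; 6]; [:: 5]; [:: 4]; [:: 3]; [:: 1]], 5, [:: Y 1 1 1; N; N; N; N]);
  ([:: [:: 8; 2]; [:: 4]; [:: 3]; [:: 5]; [:: 7; 6; 1]], 5, [:: Y 1 1 7; N; N; N; Y 2 1 6]);
  ([:: [:: 9; 5]; [:: 6]; [:: 4]; [:: 3; 8; 2]; [:: 10; 7; 1]], 6, [:: Y 0 0 4; N; N; Y 0 1 9; Y 2 1 7]);
  ([:: [:: 3; 8]; [:: 5]; [:: 7; 6; 1]; [:: 4]; [:: 2]], 5, [:: Y 0 0 7; N; Y 1 1 2; N; N]);
  ([:: [:: 9; 5]; [:: 4]; [:: 8; 7; 2]; [:: 3]; [:: 10; 6; 1]], 4, [:: Y 1 1 1; N; Y 0 0 4; N; Y 1 1 2]);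
  ([:: [:: 9; 12]; [:: 4]; [:: 11; 6; 1]; [:: 8; 10; 5]; [:: 3; 7; 2]], 5, [:: Y 0 1 4; N; Y 2 1 6; Y 1 1 6; Y 2 1 7]);
  ([:: [:: 7; 10]; [:: 9; 6; 1]; [:: 4; 8; 2]; [:: 5]; [:: 3]], 5, [:: Y 0 0 2; Y 1 0 1; Y 0 1 9; N; N]);
  ([:: [:: 2; 7]; [:: 12; 8; 3]; [:: 11; 6; 1]; [:: 4]; [:: 10; 9; 5]], 5, [:: Y 1 1 2; Y 1 1 4; Y 2 1 6; N; Y 1 0 5]);
  ([:: [:: 9; 6; 1]; [:: 4]; [:: 5]; [:: 8; 3]; [:: 7; 2]], 5, [:: Y 1 1 2; N; N; N; N])].

Definition table3 : seq (entry * nat * nat) := [::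
  (([:: [:: 10]; [:: 4]; [:: 6]; [:: 1; 7; 11; 5]; [:: 8; 2; 9; 3]], 6, [:: Y 0 0 4; N; N; Y 0 0 7; Y 1 0 9]), 5, 11);
  (([:: [:: 11; 4]; [:: 6]; [:: 5]; [:: 9; 2; 10; 3]; [:: 8; 12; 7; 1]], 6, [:: Y 0 0 4; N; N; Y 2 0 3; Y 0 0 2]), 6, 12);
  (([:: [:: 10]; [:: 5]; [:: 11; 4]; [:: 8; 2; 9; 3]; [:: 7; 12; 6; 1]], 5, [:: Y 0 1 4; N; Y 0 1 5; Y 1 0 9; Y 0 0 2]), 6, 12);
  (([:: [:: 13; 7]; [:: 4]; [:: 12; 6]; [:: 10; 5; 11; 3]; [:: 8; 1; 9; 2]], 6, [:: Y 1 1 1; N; Y 0 0 6; Y 3 1 10; Y 1 0 9]), 7, 13);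
  (([:: [:: 11]; [:: 5]; [:: 12; 9; 3]; [:: 7; 1; 8; 2]; [:: 6; 13; 10; 4]], 5, [:: Y 0 0 5; N; Y 2 1 9; Y 1 0 8; Y 3 1 10]), 6, 12);
  (([:: [:: 11; 4]; [:: 5]; [:: 14; 8; 1]; [:: 10; 3; 9; 2]; [:: 13; 7; 12; 6]], 7, [:: Y 0 1 6; N; Y 2 0 9; Y 0 1 4; Y 1 1 13]), 8, 14)].

Section Expand.
Variable en : entry.
Let sg := en.1.1.
Let s := en.1.2.
Let st := en.2.

(* Lengthening a path by two edges shifts the labels from two thresholds on, one for the
   small labels and one for the large ones. *)
Definition thresholds : seq (option (nat * nat)) :=
  [seq if p.2 is Some (i, o, t) then
         let x := nth 0 p.1 i in Some (if x <= s then (x + 1 - o, t) else (t, x + 1 - o))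
       else None | p <- zip sg st].

Definition coefs (w : nat * nat -> nat) : seq nat :=
  [seq if q is Some pq then w pq else 0 | q <- thresholds].

Definition lab (x : nat) : seq nat := x :: coefs (fun pq => (pq.1 <= x) + (pq.2 <= x)).
(** A position among the small labels may be [s.+1], where [lab] could already count insertions
    among the large labels. A position among the large labels lies above all inserted small labels,
    hence the 1 in [labC]. *)
Definition labS (t : nat) : seq nat := t :: coefs (fun pq => pq.1 <= t).
Definition labC (t : nat) : seq nat := t :: coefs (fun pq => 1 + (pq.2 <= t)).

(** The coefficient of the path's own parameter is overwritten so that both forms give the lowest
    label of a run of the zigzag: 0 for the small run, and 1 for the large run, which has to clear
    the small labels inserted by the same path. *)
Definition epiece (k : nat) (x o t : nat) : piece :=
  (Some (k, o == 0),
   if x <= s then (set_nth 0 (lab x) k.+1 0, set_nth 0 (labC t) k.+1 1)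
   else (set_nth 0 (lab x) k.+1 1, set_nth 0 (labS t) k.+1 0)).

Definition epath (k : nat) : seq piece :=
  let l := nth [::] sg k in
  [seq let x := nth 0 l j in
       if nth None st k is Some (i, o, t) then
         if j == i then epiece k x o t else (None, (lab x, [::]))
       else (None, (lab x, [::])) | j <- iota 0 (size l)].

Definition ecut : seq nat := s :: coefs (fun=> 1).

Definition elen (k : nat) : bool :=
  slen (epath k) == if nth None st k is Some _ then aadd (cst (size (nth [::] sg k))) (par k 2)
                    else cst (size (nth [::] sg k)).

Definition efit1 (k t : nat) : bool :=
  if nth None st k is Some _ then
    (size (nth [::] sg k) <= t) && ~~ odd (t - size (nth [::] sg k))
  else t == size (nth [::] sg k).

Definition efit (t0 t1 t2 t3 t4 : nat) : bool :=
  [&& efit1 0 t0, efit1 1 t1, efit1 2 t2, efit1 3 t3 & efit1 4 t4].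

(** A path of fixed length 3 or 4 would also match the truncation by [cut4] of greater lengths,
    hence the bound 2. *)
Definition esmall : bool :=
  all (fun k => size (nth [::] sg k) <= if nth None st k is Some _ then 4 else 2) (iota 0 5).

Definition eokZ : bool :=
  [&& checkZ ecut (epath 0) (epath 1) (epath 2) (epath 3) (epath 4), all elen (iota 0 5) & esmall].

Definition eok3 (s1 c2 : nat) : bool :=
  [&& check3 ecut (labS s1) (labC c2) (epath 0) (epath 1) (epath 2) (epath 3) (epath 4),
      all elen (iota 0 5) & esmall].

Definition eparam (t0 t1 t2 t3 t4 : nat) : seq nat :=
  [seq (p.2 - size (nth [::] sg p.1))./2 | p <- zip (iota 0 5) [:: t0; t1; t2; t3; t4]].

Lemma size_epath k t n : elen k -> efit1 k t ->
  nth 0 n k = (t - size (nth [::] sg k))./2 -> size (sev n (epath k)) = t.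
Proof.
move=> /eqP El; rewrite size_sev El /efit1; case: (nth _ st k) => [_|/eqP->].
  by rewrite ev_add ev_cst ev_par => H ->; lia.
by rewrite ev_cst.
Qed.

Lemma realizable_entry P t0 t1 t2 t3 t4 (n := eparam t0 t1 t2 t3 t4) :
  all elen (iota 0 5) -> efit t0 t1 t2 t3 t4 ->
  P (spider (sev n (epath 0)) [:: sev n (epath 1); sev n (epath 2)]
            [:: sev n (epath 3); sev n (epath 4)]) ->
  realizable P t0 [:: t1; t2] [:: t3; t4].
Proof.
move=> /and5P[e0 e1 e2 e3 /andP[e4 _]] /and5P[f0 f1 f2 f3 f4] HP.
do 3 eexists; split; [| | |exact: HP]; rewrite /= ?(size_epath e0 f0) //.
  by rewrite (size_epath e1 f1) // (size_epath e2 f2).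
by rewrite (size_epath e3 f3) // (size_epath e4 f4).
Qed.

(* Lengths beyond 4 behave as 3 or 4 according to their parity. *)
Definition cut4 (t : nat) : nat := if t <= 4 then t else if odd t then 3 else 4.

Lemma efit_cut4 t0 t1 t2 t3 t4 : esmall ->
  efit (cut4 t0) (cut4 t1) (cut4 t2) (cut4 t3) (cut4 t4) -> efit t0 t1 t2 t3 t4.
Proof.
have H k t : size (nth [::] sg k) <= (if nth None st k is Some _ then 4 else 2) ->
    efit1 k (cut4 t) -> efit1 k t.
  by rewrite /efit1 /cut4; case: (nth _ st k) => [_|]; case: ifP => // Ht; case: ifP => Ho; lia.
by move=> /and5P[e0 e1 e2 e3 /andP[e4 _]] /and5P[f0 f1 f2 f3 f4]; apply/and5P; split; apply: H.
Qed.

End Expand.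

(** Only legs of the same hub are exchanged, as u must keep the larger sum. *)
Definition swaps (f : nat -> nat -> nat -> nat -> nat -> bool) (t0 t1 t2 t3 t4 : nat) : bool :=
  [|| f t0 t1 t2 t3 t4, f t0 t2 t1 t3 t4, f t0 t1 t2 t4 t3 | f t0 t2 t1 t4 t3].

Lemma realizable_swaps P (f : nat -> nat -> nat -> nat -> nat -> bool) t0 t1 t2 t3 t4 :
  (forall t0 t1 t2 t3 t4, f t0 t1 t2 t3 t4 -> realizable P t0 [:: t1; t2] [:: t3; t4]) ->
  swaps f t0 t1 t2 t3 t4 -> realizable P t0 [:: t1; t2] [:: t3; t4].
Proof.
have sw (x y : nat) : perm_eq [:: x; y] [:: y; x] by rewrite (perm_catC [:: x] [:: y]).
move=> H /or4P[] /H; apply: realizable_perm => //; exact: sw.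
Qed.

(** This shape is given only a [good2] labelling, in [good2_exception]. *)
Definition exception (t0 t1 t2 t3 t4 : nat) : bool :=
  [&& t0 == 1, t1 == 1, t2 == 1, t3 == 2 & t4 == 2].

Definition coveredZ (t : seq nat) : bool :=
  if t is [:: t0; t1; t2; t3; t4] then
    [|| 1 \notin [:: t1; t2; t3; t4], exception t0 t1 t2 t3 t4 |
        has (fun en => swaps (efit en) t0 t1 t2 t3 t4) tableZ]
  else true.

Definition covered3 (t : seq nat) : bool :=
  if t is [:: t0; x; y1; y2] then
    [|| (y1 < 4), (y2 < 4), odd y1, odd y2 |
        has (fun en => swaps (efit en.1.1) t0 1 x y1 y2) table3]
  else true.

Fixpoint words (k : nat) : seq (seq nat) :=
  if k is k'.+1 then [seq x :: w | x <- iota 1 4, w <- words k'] else [:: [::]].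

Lemma mem_words (t : seq nat) : all (fun x => 0 < x <= 4) t -> t \in words (size t).
Proof.
elim: t => // x t IHt /andP[Hx /IHt Ht].
change (x :: t \in [seq y :: w | y <- iota 1 4, w <- words (size t)]).
apply/allpairsPdep; exists x, t; split => //.
by rewrite mem_iota.
Qed.

Lemma tableZ_ok en : en \in tableZ -> eokZ en.
Proof. by apply/allP: en; vm_compute. Qed.

Lemma table3_ok en : en \in table3 -> eok3 en.1.1 en.1.2 en.2.
Proof. by apply/allP: en; vm_compute. Qed.

Lemma tableZ_cover t : size t = 5 -> all (fun x => 0 < x <= 4) t -> coveredZ t.
Proof.
have H : all coveredZ (words 5) by vm_compute.
move=> E /mem_words; rewrite E; exact: (allP H).
Qed.

Lemma table3_cover t : size t = 4 -> all (fun x => 0 < x <= 4) t -> covered3 t.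
Proof.
have H : all covered3 (words 4) by vm_compute.
move=> E /mem_words; rewrite E; exact: (allP H).
Qed.

Lemma cut4_bnd t : 0 < t -> 0 < cut4 t <= 4.
Proof. by rewrite /cut4; case: ifP => [|_]; [lia | case: ifP; lia]. Qed.

Lemma cut4_small t k : k <= 2 -> (cut4 t == k) = (t == k).
Proof. by rewrite /cut4; case: (leqP t 4) => H; [lia | case: ifP; lia]. Qed.

Lemma hasZ_table t0 t1 t2 t3 t4 : all (ltn 0) [:: t0; t1; t2; t3; t4] ->
  1 \in [:: t1; t2; t3; t4] -> ~~ exception t0 t1 t2 t3 t4 -> hasZ t0 [:: t1; t2] [:: t3; t4].
Proof.
move=> /and5P[h0 h1 h2 h3 /andP[h4 _]] one nex.
have : coveredZ [:: cut4 t0; cut4 t1; cut4 t2; cut4 t3; cut4 t4].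
  by apply: tableZ_cover => //; rewrite [all _ _]/= !cut4_bnd.
case/or3P => [|| /hasP[en enT Hen]].
- by move: one; rewrite !inE ![1 == _]eq_sym !cut4_small // => ->.
- by move: nex; rewrite /exception !cut4_small // => /negbTE->.
have /and3P[ck el es] := tableZ_ok enT.
apply: (@realizable_swaps _ (fun t0 t1 t2 t3 t4 =>
  efit en (cut4 t0) (cut4 t1) (cut4 t2) (cut4 t3) (cut4 t4))) Hen => u0 u1 u2 u3 u4.
move=> /(efit_cut4 es) ft; apply: (realizable_entry el ft).
by eexists; apply: checkZ_sound ck.
Qed.

Lemma has3_table t0 x y1 y2 : 0 < t0 -> 0 < x -> 4 <= y1 -> 4 <= y2 -> ~~ odd y1 -> ~~ odd y2 ->
  has3 t0 [:: 1; x] [:: y1; y2].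
Proof.
move=> h0 hx h1 h2 o1 o2.
have : covered3 [:: cut4 t0; cut4 x; cut4 y1; cut4 y2].
  by apply: table3_cover => //; rewrite [all _ _]/= !cut4_bnd //; lia.
have cy y : 4 <= y -> ~~ odd y -> cut4 y = 4 by rewrite /cut4; case: (leqP y 4) => H; [lia | case: ifP; lia].
rewrite /covered3 (cy y1) // (cy y2) // => /hasP[[[en s1] c2] enT Hen].
have /and3P[ck el es] := table3_ok enT.
apply: (@realizable_swaps _ (fun t0 t1 t2 t3 t4 =>
  efit en (cut4 t0) (cut4 t1) (cut4 t2) (cut4 t3) (cut4 t4))).
  move=> u0 u1 u2 u3 u4 /(efit_cut4 es) ft; apply: (realizable_entry el ft).
  by do 3 eexists; apply: check3_sound ck.
by rewrite /swaps (cy y1) // (cy y2) //; exact: Hen.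
Qed.

(** * All shapes of double spiders *)

(** The sums are 2, 4, 5, 6 at the leaves, 7 and 9 at degree two, 11 at v and 12 at u. *)
Lemma good2_exception : good2 6 (spider [:: 1] [:: [:: 5]; [:: 6]] [:: [:: 3; 4]; [:: 7; 2]]).
Proof.
split => //.
- by apply/allP.
- by apply/allP.
- by apply/allP.
- by apply/allP.
- have H : allrel (fun d d' => (cls 6 d < cls 6 d') ==> (psum d < psum d'))
    [:: (3, 4); (7, 2)] [:: (3, 4); (7, 2)] by [].
  by move=> d d' dD dD'; apply/implyP; apply: (allrelP H).
- by apply/allP.
Qed.

Lemma pos_perm A B : perm_eq A B -> pos A -> pos B.
Proof. by move=> p; rewrite /pos (perm_all _ p). Qed.

Section Shapes.
Variable L : nat.
Hypothesis L0 : 0 < L.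

(* The shapes for which only [good2] labellings are constructed. *)
Definition exc (A B : seq nat) : bool :=
  [&& 2 < size B, 1 \in A & 2 \in B] || [&& L == 1, perm_eq B [:: 2; 2] & all (pred1 1) A].

Lemma has2_ones A : all (pred1 1) A -> 2 <= size A -> L = 1 -> has2 L A [:: 2; 2].
Proof.
case: A => [|x [|y A]] // /and3P[/eqP-> /eqP-> A1] _ L1.
elim: A A1 => [|z A IHA] /= => [_|/andP[/eqP-> A1]].
  do 3 eexists; split; last by exists 6; apply: good2_exception.
  - by rewrite L1.
  - by [].
  - by [].
have pA : pos [:: 1, 1 & A] by rewrite /pos /=; apply: sub_all A1 => t /eqP->.
apply: (@realizable_perm _ _ [:: 1, 1, 1 & A] [:: 2; 2]) => //.
exact: has2_add_short (IHA A1) _.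
Qed.

Section Step.
Variable N : nat.
Hypothesis IH : forall A B, sumn A + sumn B < N -> pos A -> pos B -> 2 <= size B <= size A ->
  has2 L A B /\ (~~ exc A B -> hasZ L A B).

Lemma sumn_pred A : all (ltn 1) A -> A = map succn (map predn A) /\ sumn (map predn A) <= sumn A /\
  pos (map predn A).
Proof.
elim: A => //= x A IHA /andP[x1 /IHA[E [le p]]]; rewrite -E p andbT; move: x1 le; clear.
by move=> x1 le; split; [rewrite prednK //; lia | split; lia].
Qed.

Lemma sumn_pos A : all (ltn 1) A -> 0 < size A -> sumn (map predn A) < sumn A.
Proof. by case: A => //= x A /andP[x1 /sumn_pred[_ [le _]]] _; move: x1 le; clear; lia. Qed.

(** While u has a leg of length one, it is removed together with an even leg of v, until two legs
    are left at each hub and the table applies. Otherwise peeling makes the legs of v odd and at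
    least three; that shape is outside [exc], so the induction hypothesis provides the [goodZ]
    labelling for [has3_peel]. *)
Lemma has3_even A B : size A = size B -> 2 <= size B -> pos A ->
  all (fun y => (4 <= y) && ~~ odd y) B -> sumn A + sumn B <= N -> has3 L A B.
Proof.
elim: B A => // y B IHB A sAB s2 pA /= /andP[/andP[y4 yo] B4] sN.
have pB : pos B by apply: sub_all B4 => t /andP[]; case: t.
have [A1|A1] := boolP (1 \in A); last first.
  have A2 : all (ltn 1) A.
    apply/allP => t tA; have := allP pA t tA; have : t != 1 by apply: contraNneq A1 => <-.
    by rewrite /=; lia.
  have B2 : all (ltn 1) (y :: B).
    by rewrite /= (_ : 1 < y) /=; [apply: sub_all B4 => t /andP[]; rewrite /=; lia | lia].
  have [EA [_ pA']] := sumn_pred A2; have [EB [leB pB']] := sumn_pred B2.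
  rewrite EA EB; apply: has3_peel => //; last by rewrite !size_map sAB leqnn s2.
  apply: (proj2 (IH _ _ _ _)) => //.
  - by have := @sumn_pos A A2; move: leB => /=; lia.
  - by rewrite !size_map sAB leqnn s2.
  - have odd3 (t : nat) : t \in map predn (y :: B) -> odd t && (2 < t).
      have yB4 : all (fun y => (4 <= y) && ~~ odd y) (y :: B) by rewrite /= y4 yo.
      by case/mapP => z /(allP yB4) /= H ->; move: H; clear; lia.
    have n2 : 2 \notin map predn (y :: B) by apply/negP => /odd3.
    rewrite /exc negb_or; apply/andP; split; apply: contra n2; first by case/and3P.
    by case/and3P => _ /perm_mem->.
have pA1 := perm_to_rem A1; set A' := rem 1 A in pA1.
have pA' : pos A' by have := pos_perm pA1 pA => /andP[].
have sA' : size A' = size B by have := perm_size pA1; rewrite sAB /= => -[].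
apply: (@realizable_perm _ _ (1 :: A') (y :: B)) => //; first by rewrite perm_sym.
case: B IHB sAB s2 B4 sN pB sA' => // z [|w B] IHB sAB s2 B4 sN pB sA'.
  case: (A') sA' pA' => [|x [|]] // _ /andP[x0 _].
  by case/andP: B4 => /andP[z4 zo] _; apply: has3_table.
have [g [-> g0]] : exists g, y = 2 * g.+1 /\ 0 < g.
  by exists y./2.-1; move: y4 yo; clear; lia.
have s2' : 2 <= size [:: z, w & B] <= size A' by rewrite sA' leqnn.
apply: has3_add_pair => //.
by apply: IHB => //; have := perm_sumn pA1; rewrite /= in sN *; lia.
Qed.

Lemma step A B : sumn A + sumn B <= N -> pos A -> pos B -> 2 <= size B <= size A ->
  has2 L A B /\ (~~ exc A B -> hasZ L A B).
Proof.
move=> sN pA pB sAB; have /andP[s2 sBA] := sAB.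
have [ex|nex] := boolP (exc A B).
  split => //; case/orP: ex => [/and3P[b3 A1 B2]|/and3P[/eqP L1 pB2 A1]]; last first.
    apply: (@realizable_perm _ _ A [:: 2; 2]) => //; first by rewrite perm_sym.
    by apply: has2_ones => //; apply: leq_trans sBA.
  have pA1 := perm_to_rem A1; set A' := rem 1 A in pA1.
  have pB1 := perm_to_rem B2; set B' := rem 2 B in pB1.
  apply: (@realizable_perm _ _ (1 :: A') (2 :: B')); rewrite 1?perm_sym //.
  have /andP[_ pA'] := pos_perm pA1 pA; have /andP[_ pB'] := pos_perm pB1 pB.
  have := perm_size pA1; have := perm_size pB1; have := perm_sumn pA1; have := perm_sumn pB1.
  rewrite /= => E1 E2 E3 E4; apply: has2_add_pair => //; last lia.
  by apply: (proj1 (IH _ _ _ _)) => //; lia.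
suff HZ : hasZ L A B by split => //; apply: hasZ2.
move: nex; rewrite negb_or => /andP[nex1 nex2].
move: sBA; rewrite leq_eqVlt => /orP[/eqP sE|sBA]; last first.
  (* The leg to remove is chosen so that the rest stays outside [exc]: if some leg of u is longer
     than one, such a leg is kept. *)
  have [y [A' [pA1 ex']]] : exists y A', perm_eq A (y :: A') /\ ~~ exc A' B.
    have sub y A' : perm_eq A (y :: A') -> ~~ [&& 2 < size B, 1 \in A' & 2 \in B].
      move=> p; apply: contra nex1 => /and3P[-> A'1 ->].
      by rewrite (perm_mem p) inE A'1 orbT.
    have [all1|/allPn[x xA x1]] := boolP (all (pred1 1) A).
      case: A {pA sN sAB sub} all1 nex1 nex2 sBA => // y A' /= /andP[y1 A1] n1 n2 _.
      exists y, A'; split => //; rewrite negb_or; apply/andP; split.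
        by apply: contra n1 => /and3P[-> A'1 ->]; rewrite inE A'1 orbT.
      by apply: contra n2 => /and3P[-> -> _]; rewrite y1.
    have pA1 := perm_to_rem xA; case E: (rem x A) => [|y A'] in pA1.
      by have := perm_size pA1 => /=; lia.
    have pA2 : perm_eq A [:: y, x & A'].
      by apply: perm_trans pA1 _; apply/permP => p /=; lia.
    exists y, (x :: A'); split => //; rewrite negb_or (sub y) //=.
    by move: x1 => /= /negbTE->; rewrite !andbF.
  have /andP[y0 pA'] := pos_perm pA1 pA.
  apply: (@realizable_perm _ _ (y :: A') B) => //; first by rewrite perm_sym.
  have := perm_size pA1; have := perm_sumn pA1; rewrite /= => E1 E2.
  apply: hasZ_add_u => //; last lia.
  by apply: (proj2 (IH _ _ _ _)) => //; rewrite /= in y0; lia.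
(* Now the numbers of legs agree, so removing an odd leg of v gives the strict inequality needed to
   add it back. *)
have [/andP[b3 /hasP[y yB yo]]|even] := boolP ((2 < size B) && has odd B).
  have pB1 := perm_to_rem yB; set B' := rem y B in pB1.
  have /andP[y0 pB'] := pos_perm pB1 pB.
  have := perm_size pB1; have := perm_sumn pB1; rewrite /= => E1 E2.
  apply: (@realizable_perm _ _ A (y :: B')) => //; first by rewrite perm_sym.
  apply: hasZ_add_v => //; last lia.
  apply: (proj2 (IH _ _ _ _)) => //; [by rewrite /= in y0; lia | lia |].
  rewrite negb_or; apply/andP; split.
    by apply: contra nex1 => /and3P[_ -> B2]; rewrite b3 (perm_mem pB1) inE B2 orbT.
  apply: contra nex1 => /and3P[_ pB2 A1]; rewrite b3 (perm_mem pB1) inE (perm_mem pB2) orbT andbT.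
  by case: A A1 sE {pA sN sAB nex2} => [|x A /andP[/eqP-> _]]; [move: b3; case: (B) | rewrite inE].
have [no1|has1] := boolP (1 \notin A ++ B).
  have gt1 X : pos X -> {subset X <= A ++ B} -> all (ltn 1) X.
    move=> pX sX; apply/allP => t tX; have := allP pX t tX.
    have : t != 1 by apply: contraNneq no1 => <-; apply: sX.
    by rewrite /=; lia.
  have A2 : all (ltn 1) A by apply: gt1 => // t; rewrite mem_cat => ->.
  have B2 : all (ltn 1) B by apply: gt1 => // t; rewrite mem_cat => ->; rewrite orbT.
  have [EA [leA pA']] := sumn_pred A2; have [EB [leB pB']] := sumn_pred B2.
  rewrite EA EB; apply: hasZ_peel => //; last by rewrite !size_map.
  apply: (proj1 (IH _ _ _ _)) => //; last by rewrite !size_map.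
  by have := @sumn_pos A A2; lia.
move: has1; rewrite negbK mem_cat => has1.
case: (ltngtP 2 (size B)) => [b3|b1|b2]; [|lia|].
  (* All legs of v are even, so a leg of length one is at u; being outside [exc] then excludes
     length two at v. *)
  move: even; rewrite b3 /= => /hasPn even.
  have A1 : 1 \in A by case/orP: has1 => // /even.
  have n2 : 2 \notin B by move: nex1; rewrite b3 A1.
  apply: has3Z; apply: has3_even => //.
  apply/allP => t tB; have := even t tB => te; rewrite te andbT.
  have := allP pB t tB; have : t != 2 by apply: contraNneq n2 => <-.
  by move: te; rewrite /=; lia.
case: B {nex1 sAB even sN} b2 sE pB has1 nex2 s2 => [|y1 [|y2 [|? ?]]] // _.
case: A pA => [|x1 [|x2 [|? ?]]] // pA _ pB has1 nex2 _.
case/and3P: pA pB => x10 x20 _ /and3P[y10 y20 _]; apply: hasZ_table.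
- by apply/and5P; split => //; rewrite /= andbT.
- by move: has1; rewrite !inE -!orbA.
- apply: contra nex2 => /and5P[-> /eqP-> /eqP-> /eqP-> /eqP->].
  by rewrite perm_refl.
Qed.

End Step.

Theorem has2_all A B : pos A -> pos B -> 2 <= size B <= size A -> has2 L A B.
Proof.
suff H N : sumn A + sumn B < N -> pos A -> pos B -> 2 <= size B <= size A ->
    has2 L A B /\ (~~ exc A B -> hasZ L A B).
  by move=> pA pB sAB; case: (H (sumn A + sumn B).+1).
elim: N A B => // N IHN A B; rewrite ltnS; exact: step.
Qed.

End Shapes.

(** * Rooted trees *)

Lemma set2_eq (T : finType) (x y z w : T) : [set x; y] = [set z; w] ->
  (x = z /\ y = w) \/ (x = w /\ y = z).
Proof.
move=> E; have := set21 x y; have := set22 x y; rewrite !E !inE.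
have := set21 z w; have := set22 z w; rewrite -!E !inE.
by do 4![case/orP => /eqP ?]; subst; auto.
Qed.

Section Rooting.
Variables (T : finType) (e : rel T) (u : T).
Hypothesis sym_e : symmetric e.
Hypothesis con_e : forall x y : T, connect e x y.
Hypothesis card_e : #|edges e| + 1 = #|T|.

(** [d] is the distance from [u], and [y] the last vertex but one of a shortest path to [x]. *)
Lemma height_exists : exists d : T -> nat, forall x, x != u -> exists y, e x y && (d y < d x).
Proof.
have E x : exists n, [exists p : n.-tuple T, path e u p && (last u p == x)].
  have /connectP[p ep ->] := con_e u x; exists (size p); apply/existsP; exists (in_tuple p).
  by rewrite ep eqxx.
pose d x := ex_minn (E x); exists d => x xu.
rewrite {2}/d; case: ex_minnP => n /existsP[[p /= /eqP sp] /andP[ep /eqP lx]] _.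
case/lastP: p sp ep lx => [|p z] sp; first by move=> _ /= E1; rewrite -E1 eqxx in xu.
rewrite last_rcons rcons_path => /andP[ep ez] zx; subst z.
exists (last u p); rewrite sym_e ez /= /d; case: ex_minnP => k _ kmin.
move: sp; rewrite size_rcons => <-; rewrite ltnS; apply: kmin.
by apply/existsP; exists (in_tuple p); rewrite ep eqxx.
Qed.

(** Sending a vertex other than [u] to the edge to its parent is injective, because heights
    decrease. There are as many edges as such vertices, so every edge is of this form. *)
Lemma parent_exists : exists (par : T -> T) (d : T -> nat),
  (forall x, x != u -> d (par x) < d x) /\
  (forall x y, e x y = ((x != u) && (par x == y)) || ((y != u) && (par y == x))).
Proof.
have [d dP] := height_exists.
have /fin_all_exists[par parP] x : exists y : T, x != u -> e x y && (d y < d x).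
  by have [->|/dP[y yP]] := eqVneq x u; [exists u | exists y].
exists par, d; split=> [x /parP/andP[]//|x y].
pose h x := [set x; par x].
have inj_h : {in [set~ u] &, injective h}.
  move=> x1 x2; rewrite !inE => /parP/andP[_ d1] /parP/andP[_ d2] /set2_eq[[]//|[E1 E2]].
  by move: d1 d2; rewrite E2 -E1 => d1 d2; have := ltn_trans d1 d2; rewrite ltnn.
have im_h : h @: [set~ u] = edges e.
  apply/eqP; rewrite eqEcard card_in_imset // cardsC1; apply/andP; split; last first.
    by rewrite -card_e addn1.
  apply/subsetP => _ /imsetP[z zC ->]; move: zC; rewrite !inE => zu.
  apply/existsP; exists z; apply/existsP; exists (par z).
  by have /andP[-> _] := parP z zu; rewrite /= eqxx.
apply/idP/idP => [exy|].
  have : [set x; y] \in edges e.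
    by rewrite inE; apply/existsP; exists x; apply/existsP; exists y; rewrite exy eqxx.
  rewrite -im_h => /imsetP[z]; rewrite !inE => zu /set2_eq[[-> ->]|[-> ->]].
    by rewrite zu eqxx.
  by rewrite zu eqxx orbT.
case/orP => /andP[zu /eqP <-]; first by have /andP[] := parP x zu.
by rewrite sym_e; have /andP[] := parP y zu.
Qed.

End Rooting.

(** * Decomposition of the rooted tree into descending chains *)

Section Chains.
Variables (T : finType) (u v : T) (par : T -> T) (d : T -> nat).
Hypothesis d_par : forall x, x != u -> d (par x) < d x.

Definition chd (x y : T) := (y != u) && (par y == x).
Hypothesis chd_uniq : forall x y z, x != u -> x != v -> chd x y -> chd x z -> y = z.

Definition chain_spec (x : T) (s : seq T) : Prop :=
  [/\ path chd x s, v \notin belast x s & last x s = v \/ (forall y, ~~ chd (last x s) y)].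

Lemma chain_exists x : exists s, chain_spec x s.
Proof.
pose D := \max_x d x.
(* Heights grow along the chain and are at most [D], so [n] bounds its length. *)
have [n] : exists n, D < d x + n by exists D.+1; rewrite addnS ltnS leq_addl.
elim: n x => [|n IHn] x; first by rewrite addn0 ltnNge leq_bigmax.
move=> Dx; have [xv|xv] := eqVneq x v; first by exists [::]; split => //; left.
case: (pickP (chd x)) => [y xy|no]; last by exists [::]; split => //; right => y; rewrite no.
have [|s [p nv l]] := IHn y.
  case/andP: xy => yu /eqP yx; have := d_par yu; rewrite yx => dxy.
  by apply: leq_trans Dx _; rewrite addnS -addSn leq_add2r.
by exists (y :: s); split; rewrite //= ?xy // inE eq_sym negb_or xv.
Qed.

Lemma chd_d x y : chd x y -> d x < d y.
Proof. by case/andP => yu /eqP <-; apply: d_par. Qed.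

Lemma chain_uniq x s : path chd x s -> uniq (x :: s).
Proof.
move=> p; apply: (@sorted_uniq _ (relpre d ltn)) => [a b c|a|]; [exact: ltn_trans | exact: ltnn |].
by apply: sub_path p => a b; apply: chd_d.
Qed.

Lemma chain_pred x s y : path chd x s -> y \in s -> (par y \in belast x s) && (y != u).
Proof.
elim: s x => //= z s IHs x /andP[/andP[zu /eqP <-] p]; rewrite !inE => /orP[/eqP->|ys].
  by rewrite eqxx.
by have /andP[-> ->] := IHs _ p ys; rewrite orbT.
Qed.

Lemma chain_succ x s y (lab : T -> nat) : path chd x s -> y \in belast x s ->
  exists2 z, chd y z & (z \in s) && ((lab y, lab z) \in adjs (map lab (x :: s))).
Proof.
elim: s x => //= z s IHs x /andP[xz p]; rewrite inE => /orP[/eqP->|/(IHs _ p)[w yw /andP[ws H]]].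
  by exists z => //; rewrite !inE !eqxx.
by exists w => //; rewrite !inE ws orbT /=; apply/orP; right.
Qed.

Variable ch : T -> seq T.
Hypothesis chP : forall x, chain_spec x (ch x).

Definition heads := enum (chd u) ++ enum (chd v).
Hypothesis uv : u != v.

Lemma mem_heads x : (x \in heads) = chd u x || chd v x.
Proof. by rewrite mem_cat !mem_enum. Qed.

Lemma heads_uniq : uniq heads.
Proof.
rewrite cat_uniq !enum_uniq andbT /=; apply/hasPn => x; rewrite !mem_enum.
rewrite !unfold_in => /andP[_ /eqP pv]; rewrite /chd pv negb_and.
by rewrite [v == u]eq_sym uv orbT.
Qed.

Lemma head_neq_u x y : x \in heads -> y \in x :: ch x -> y != u.
Proof.
rewrite mem_heads inE => xh /orP[/eqP->|]; first by case/orP: xh => /andP[].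
by have [p _ _] := chP x; case/(chain_pred p)/andP.
Qed.

(** By induction on the height the parent lies on a chain. Unless it is a hub, it has [y] as its
    only child, so that chain continues with [y]. *)
Lemma chain_cover y : y != u -> exists2 x, x \in heads & y \in x :: ch x.
Proof.
have [n] := ubnP (d y); elim: n y => // n IHn y; rewrite ltnS => dy yu.
have [pu|pu] := eqVneq (par y) u.
  by exists y; rewrite ?mem_head // mem_heads /chd yu pu eqxx.
have [pv|pv] := eqVneq (par y) v.
  by exists y; rewrite ?mem_head // mem_heads /chd yu pv eqxx orbT.
have [|x xh px] := IHn (par y) _ pu; first exact: leq_trans (d_par yu) dy.
have [p nv l] := chP x; exists x => //.
move: px; rewrite lastI mem_rcons inE => /orP[/eqP lx|pb].
  case: l => [lv|/(_ y)]; first by rewrite lx lv eqxx in pv.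
  by rewrite /chd yu lx eqxx.
have [z yz /andP[zs _]] := @chain_succ _ _ _ d p pb.
have -> : y = z by apply: (chd_uniq pu pv _ yz); rewrite /chd yu eqxx.
by rewrite -lastI inE zs orbT.
Qed.

Lemma chain_nonhead x y : x \in heads -> y \in ch x -> y \notin heads.
Proof.
move=> xh ys; have [p nv _] := chP x; have /andP[pb yu] := chain_pred p ys.
rewrite mem_heads /chd yu /= negb_or; apply/andP; split; last by apply: contraNneq nv => <-.
by apply: (head_neq_u xh); rewrite lastI mem_rcons inE pb orbT.
Qed.

Lemma chain_inj x x' y : x \in heads -> x' \in heads -> y \in x :: ch x -> y \in x' :: ch x' -> x = x'.
Proof.
have [n] := ubnP (d y); elim: n y => // n IHn y; rewrite ltnS => dy xh xh' yx yx'.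
move: (yx) (yx'); rewrite !inE => /orP[/eqP E|ys] /orP[/eqP E'|ys'].
- by rewrite -E -E'.
- by have := chain_nonhead xh' ys'; rewrite E xh.
- by have := chain_nonhead xh ys; rewrite E' xh'.
have [p _ _] := chP x; have [p' _ _] := chP x'.
have /andP[b yu] := chain_pred p ys; have /andP[b' _] := chain_pred p' ys'.
apply: (IHn (par y)) => //; first exact: leq_trans (d_par yu) dy.
  by rewrite lastI mem_rcons inE b orbT.
by rewrite lastI mem_rcons inE b' orbT.
Qed.

Lemma flatten_chains_uniq H : uniq H -> {subset H <= heads} -> uniq (flatten [seq x :: ch x | x <- H]).
Proof.
elim: H => // x H IHH /andP[xH uH] sub; have xh := sub x (mem_head _ _).
have sub' : {subset H <= heads} by move=> y yH; apply: sub; rewrite inE yH orbT.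
have [p _ _] := chP x; rewrite -[flatten _]/((x :: ch x) ++ flatten [seq x :: ch x | x <- H]).
rewrite cat_uniq chain_uniq // IHH // andbT.
apply/hasPn => y /flatten_mapP[z zH yz]; apply: contra xH => yx.
by rewrite (chain_inj xh (sub' z zH) yx yz).
Qed.

(** The chain through [v] stops there. Its head cannot be a child of [v], since heights grow along
    chains. *)
Lemma core_exists : exists2 c, chd u c & last c (ch c) = v.
Proof.
have vu : v != u by rewrite eq_sym.
have [c ch_c vc] := chain_cover vu; have [p nv _] := chP c.
have lc : last c (ch c) = v.
  by move: vc; rewrite lastI mem_rcons inE (negbTE nv) orbF => /eqP.
exists c => //; move: ch_c; rewrite mem_heads => /orP[//|/chd_d vc'].
have : all (relpre d ltn c) (ch c).
  apply: (@order_path_min _ (relpre d ltn)); first by move=> a b e; apply: ltn_trans.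
  by apply: sub_path p => a b; apply: chd_d.
move/allP => dc; move: vc; rewrite inE => /orP[/eqP E|/dc /= d2]; first by rewrite -E ltnn in vc'.
by have := ltn_trans vc' d2; rewrite ltnn.
Qed.

End Chains.

(** * From label lists to labellings of the tree *)

Lemma perm_map_lift (S : eqType) (f : S -> nat) (s : seq S) t : perm_eq (map f s) t ->
  exists2 s', perm_eq s s' & map f s' = t.
Proof.
elim: t s => [|y t IHt] s p.
  by exists [::] => //; move/perm_size: p; rewrite size_map => /size0nil->.
have /mapP[x xs yE] : y \in map f s by rewrite (perm_mem p) mem_head.
have px := perm_to_rem xs.
have [|s' ps' E] := IHt (rem x s).
  by rewrite -(perm_cons y) {1}yE; apply: perm_trans p; rewrite perm_sym; apply: (perm_map f px).
by exists (x :: s'); rewrite ?(perm_trans px) ?perm_cons //= E yE.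
Qed.

Lemma spider_perm core LU LV LU' LV' : perm_eq LU LU' -> perm_eq LV LV' ->
  cperm (spider core LU LV) (spider core LU' LV').
Proof.
move=> pU pV; split; rewrite /= ?perm_cat2l ?perm_cons ?perm_map //.
- by apply: perm_cat; apply: perm_flatten.
- by apply: perm_cat; apply: perm_flatten; apply: perm_map.
- by apply: perm_cat; apply: perm_map.
Qed.

Lemma label_function (S : eqType) (X : seq (seq S)) (Y : seq (seq nat)) :
  uniq (flatten X) -> shape X = shape Y -> exists lab : S -> nat, map (map lab) X = Y.
Proof.
move=> uX sXY; exists (fun x => nth 0 (flatten Y) (index x (flatten X))).
apply: eq_from_flatten_shape; last first.
  by rewrite -sXY /shape -map_comp; apply: eq_map => s /=; rewrite size_map.
rewrite -map_flatten; case E: (flatten X) => [|x0 X'].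
  by apply/esym/size0nil; rewrite size_flatten -sXY -size_flatten E.
rewrite -E; apply: (@eq_from_nth _ 0) => [|i]; rewrite size_map; first by rewrite !size_flatten sXY.
by move=> iX; rewrite (nth_map x0) // index_uniq.
Qed.

Lemma uniq_map_inj (S S' : eqType) (f : S -> S') (s : seq S) : uniq (map f s) -> {in s &, injective f}.
Proof.
elim: s => //= x s IHs /andP[fx us] y z; rewrite !inE => /orP[/eqP->|ys] /orP[/eqP->|zs] // E.
- by rewrite E map_f in fx.
- by rewrite -E map_f in fx.
- exact: IHs E.
Qed.

Section Labelling.
Variables (T : finType) (e : rel T) (u : T) (par : T -> T) (d : T -> nat).
Hypothesis d_par : forall x, x != u -> d (par x) < d x.
Hypothesis eE : forall x y, e x y = ((x != u) && (par x == y)) || chd u par x y.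

Lemma chd_asym x y : x != u -> par x == y -> chd u par x y = false.
Proof.
move=> xu /eqP <-; apply/negP => /andP[yu /eqP pp].
by have := d_par yu; rewrite pp ltnNge ltnW // d_par.
Qed.

Lemma sum_neighbours x (F : T -> nat) :
  \sum_(y | e x y) F y = (if x != u then F (par x) else 0) + \sum_(y | chd u par x y) F y.
Proof.
rewrite (bigID (chd u par x)) /= addnC; congr addn; last first.
  by apply: eq_bigl => y; rewrite eE; case: (chd _ _ _ _); rewrite ?orbT ?andbF.
case: ifPn => [xu|/negbNE/eqP xu].
  rewrite (big_pred1 (par x)) // => y; rewrite eE xu /= eq_sym.
  by case: eqVneq => [->|_] /=; [rewrite chd_asym | case: (chd _ _ _ _)].
by rewrite big_pred0 // => y; rewrite eE xu eqxx /=; case: (chd _ _ _ _).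
Qed.

Lemma deg_children x : deg e x = (x != u) + #|chd u par x|.
Proof. by rewrite /deg cardsE -sum1_card sum_neighbours sum1_card; case: ifP. Qed.

Lemma edgesP A : reflect (exists2 x, x != u & A = [set x; par x]) (A \in edges e).
Proof.
rewrite inE; apply: (iffP existsP) => [[x /existsP[y /andP[]]]|[x xu ->]].
  rewrite eE => /orP[/andP[xu /eqP <-]|/andP[yu /eqP <-]] /eqP->; first by exists x.
  by exists y => //; rewrite setUC.
by exists x; apply/existsP; exists (par x); rewrite eE xu !eqxx.
Qed.

Variable lab : T -> nat.

(** In the rooted tree an edge is identified with its end farther from [u], so [lab] assigns labels
    to vertices. *)
Definition edge_label (A : {set T}) : nat :=
  if [pick x in A | (x != u) && (par x \in A)] is Some x then lab x else 0.

Lemma edge_labelE x : x != u -> edge_label [set x; par x] = lab x.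
Proof.
move=> xu; rewrite /edge_label; case: pickP => [y|/(_ x)]; last by rewrite !inE xu !eqxx orbT.
rewrite !inE => /and3P[/orP[/eqP->//|/eqP E] yu /orP[/eqP pp|/eqP pp]].
  by have := d_par yu; rewrite pp E ltnNge ltnW // d_par.
by have := d_par yu; rewrite pp E ltnn.
Qed.

Lemma vsum_edge_label x :
  vsum e edge_label x = (if x != u then lab x else 0) + \sum_(y | chd u par x y) lab y.
Proof.
rewrite /vsum sum_neighbours; congr addn; first by case: ifPn => // xu; rewrite edge_labelE.
by apply: eq_bigr => y /andP[yu /eqP <-]; rewrite setUC edge_labelE.
Qed.

End Labelling.

(** Here [lab x] stands for the label of the edge from [x] to its parent, and a vertex of degree two
    is an [x] with its only child [z]. Since [v] has a parent and [u] has none, the bounds on the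
    children mean that both degrees are at least three and that of [u] is no smaller. *)
Lemma tree_labels (T : finType) (u v : T) (par : T -> T) (d : T -> nat)
    (V := fun lab => lab v + \sum_(y | chd u par v y) lab y)
    (U := fun lab => \sum_(y | chd u par u y) lab y) :
  (forall x, x != u -> d (par x) < d x) ->
  (forall x y z, x != u -> x != v -> chd u par x y -> chd u par x z -> y = z) ->
  u != v -> 2 <= #|chd u par v| < #|chd u par u| ->
  exists (lab : T -> nat) (M : nat),
  [/\ {in predC1 u &, injective lab}, forall x, x != u -> 0 < lab x < #|T|,
      M < V lab & V lab < U lab] /\
  [/\ forall x, x != u -> x != v -> (forall y, ~~ chd u par x y) -> lab x <= M,
      forall x z, x != u -> x != v -> chd u par x z -> M < lab x + lab z < V lab &
      forall x z x' z', x != u -> x != v -> x' != u -> x' != v -> chd u par x z ->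
        chd u par x' z' -> lab x + lab z = lab x' + lab z' -> x = x'].
Proof.
move=> d_par chd1 uv card_uv.
have /fin_all_exists[ch chP] := chain_exists v d_par.
have [c uc cv] := core_exists d_par chd1 chP uv.
pose hu := rem c (enum (chd u par u)); pose hv := enum (chd u par v).
have cu : c \in enum (chd u par u) by rewrite mem_enum.
have pu : perm_eq (enum (chd u par u)) (c :: hu) := perm_to_rem cu.
have ph : perm_eq (heads u v par) (c :: hu ++ hv) by rewrite -cat_cons perm_cat2r.
pose leg x := x :: ch x.
pose X := map leg (c :: hu ++ hv).
have uX : uniq (flatten X).
  apply: (flatten_chains_uniq d_par chP); first by rewrite -(perm_uniq ph) heads_uniq.
  by move=> x; rewrite (perm_mem ph).
have covX x : x != u -> exists2 h, h \in c :: hu ++ hv & x \in leg h.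
  by case/(chain_cover d_par chd1 chP) => h hh xh; exists h; rewrite // -(perm_mem ph).
have memX x : (x \in flatten X) = (x != u).
  apply/idP/idP => [/flatten_mapP[h]|/covX[h hh xh]]; last by apply/flatten_mapP; exists h.
  by rewrite -(perm_mem ph) => hh; apply: (head_neq_u chP hh).
have sX : size (flatten X) = #|T|.-1.
  rewrite -(cardC1 u) -(card_uniqP uX); apply: eq_card => x; by rewrite memX !inE.
pose A := map size (map leg hu); pose B := map size (map leg hv).
have sizeA : size A = #|chd u par u|.-1 by rewrite !size_map cardE (perm_size pu).
have sizeB : size B = #|chd u par v| by rewrite !size_map cardE.
have posL H : pos (map size (map leg H)) by rewrite /pos !all_map; apply/allP.
have sAB : 2 <= size B <= size A by rewrite sizeA sizeB; move: card_uv; clear; lia.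
have [core [LU [LV [sc pA pB [M G]]]]] := @has2_all (size (leg c)) isT A B (posL hu) (posL hv) sAB.
have [LU' pU' sU] := perm_map_lift pA; have [LV' pV' sV] := perm_map_lift pB.
have {}G := good2_perm (spider_perm core pU' pV') G.
have [|lab] := @label_function T X (core :: LU' ++ LV') uX.
  by rewrite /shape /X !map_cons !map_cat sU sV sc.
rewrite /X !map_cons !map_cat => -[cE' /eqP].
rewrite eqseq_cat ?size_map; last by have := congr1 size sU; rewrite !size_map.
case/andP => /eqP UE /eqP VE.
have {}cE' : core = map lab (leg c) by rewrite -cE'.
move: G; rewrite cE' -UE -VE; set cc := spider _ _ _ => G.
have LE : cL cc = map lab (flatten X).
  have -> : flatten X = leg c ++ flatten (map leg hu) ++ flatten (map leg hv).
    by rewrite -flatten_cat -map_cat.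
  by rewrite !map_cat !map_flatten.
have DE : cD cc = flatten [seq adjs (map lab (leg h)) | h <- c :: hu ++ hv].
  by rewrite /= map_cat flatten_cat -!map_comp.
have EE : cE cc = [seq lab (last h (ch h)) | h <- hu ++ hv].
  by rewrite /= map_cat -!map_comp; congr cat; apply: eq_map => h /=; rewrite last_map.
have sumE s : sumn (map lab s) = \sum_(y <- s) lab y by rewrite sumnE big_map.
have VE' : sumn (cV cc) = V lab.
  rewrite /V -big_enum -sumE /= last_map cv; congr (_ + sumn _).
  by rewrite -!map_comp.
have UE' : sumn (cU cc) = U lab.
  rewrite /U -big_enum (perm_big _ pu) -sumE /=; congr (_ + sumn _).
  by rewrite -!map_comp.
have inner x h : x != v -> h \in c :: hu ++ hv -> x \in leg h ->
    (exists2 z, chd u par x z & (lab x, lab z) \in cD cc) \/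
    (x = last h (ch h) /\ forall y, ~~ chd u par x y).
  move=> xv hh; have [p _ l] := chP h; rewrite /leg lastI mem_rcons inE => /orP[/eqP E|xb].
    by right; split => //; case: l; rewrite -E // => E'; rewrite E' eqxx in xv.
  left; have [z xz /andP[_ zD]] := chain_succ lab p xb; exists z => //.
  by rewrite DE; apply/flatten_mapP; exists h.
have pairD x z : x != u -> x != v -> chd u par x z -> (lab x, lab z) \in cD cc.
  move=> xu xv xz; have [h hh xh] := covX x xu.
  have [[z' xz' zD]|[_ /(_ z)]] := inner x h xv hh xh; last by rewrite xz.
  by rewrite (chd1 x z z').
have labI : {in predC1 u &, injective lab}.
  move=> x y; rewrite !inE -!memX; apply: uniq_map_inj; rewrite -LE; exact: g_uniq G.
exists lab, M; split; split => //.
- move=> x xu; have := @g_bnd _ _ G (lab x); rewrite LE size_map sX.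
  rewrite map_f ?memX // => /(_ isT) /andP[-> h]; apply: leq_ltn_trans h _.
  by rewrite prednK //; apply/card_gt0P; exists u.
- by rewrite -VE'; apply: g_MV G.
- by rewrite -VE' -UE'; apply: g_UV G.
- move=> x xu xv no; have [h hh xh] := covX x xu.
  have [[z xz _]|[xE _]] := inner x h xv hh xh; first by have := no z; rewrite xz.
  apply: (g_leaf G); rewrite EE; apply/mapP; exists h; last by rewrite -xE.
  (* The core ends at [v], so the leaf ends one of the legs. *)
  move: hh; rewrite inE => /orP[/eqP hc|//]; by rewrite xE hc cv eqxx in xv.
- move=> x z xu xv /(pairD x z xu xv) xzD; rewrite -VE'.
  by have := g_low G xzD; have := g_V G xzD; rewrite /psum /= => -> ->.
move=> x z x' z' xu xv xu' xv' /(pairD x z xu xv) xzD /(pairD x' z' xu' xv') xzD' E.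
have := @uniq_map_inj _ _ psum (cD cc) (g_sums G) _ _ xzD xzD'; rewrite /psum /= => /(_ E) [lx _].
by apply: labI.
Qed.

Theorem theorem2 (T : finType) (e : rel T) :
  simple_graph e -> double_spider e -> strongly_antimagic e.
Proof.
case=> sym_e irr_e; case=> -[_ [con_e card_e]] /eqP/cards2P[u0 [v0 [uv0 hub0]]].
have [u [v [uv hub duv]]] : exists u v, [/\ u != v, forall x, (3 <= deg e x) = (x == u) || (x == v) &
    deg e v <= deg e u].
  have h x : (3 <= deg e x) = (x == u0) || (x == v0) by have /setP/(_ x) := hub0; rewrite !inE.
  case/orP: (leq_total (deg e v0) (deg e u0)) => le; first by exists u0, v0.
  by exists v0, u0; split => // [|x]; [rewrite eq_sym | rewrite h orbC].
have [par [d [d_par eE]]] := @parent_exists _ _ u sym_e con_e card_e.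
have degE := deg_children d_par eE.
have chd1 x y z : x != u -> x != v -> chd u par x y -> chd u par x z -> y = z.
  move=> xu xv; have := hub x; rewrite (negbTE xu) (negbTE xv) degE xu add1n ltnS.
  move/negbT; rewrite -leqNgt => /card_le1P c1 xy xz.
  by have : z \in pred1 y; [rewrite -(c1 y xy z) | move/eqP].
have card_uv : 2 <= #|chd u par v| < #|chd u par u|.
  move: duv (hub v); rewrite !degE eqxx eq_sym uv eqxx orbT /=; clear; lia.
have [lab [M [[labI labB MV VU] [leafM innerB innerI]]]] := tree_labels d_par chd1 uv card_uv.
pose f := edge_label u par lab; exists f.
set SV := lab v + _ in MV VU innerB; set SU := \sum_(y | _) _ in VU.
have vsE x : vsum e f x = (if x != u then lab x else 0) + \sum_(y | chd u par x y) lab y.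
  exact: vsum_edge_label d_par eE lab x.
have fE x : x != u -> f [set x; par x] = lab x := @edge_labelE _ _ _ _ d_par lab x.
have childless x : #|chd u par x| = 0 -> (forall y, ~~ chd u par x y).
  by move/eqP/pred0P => no y; have /= -> := no y.
have child x : x != u -> x != v -> 0 < #|chd u par x| -> exists2 z, chd u par x z &
    forall F : T -> nat, \sum_(y | chd u par x y) F y = F z.
  move=> xu xv /card_gt0P[z xz]; exists z => // F; apply: big_pred1 => y /=.
  by apply/idP/eqP => [xy|->//]; apply: chd1 xy xz.
(* Leaves, vertices of degree two, [v] and [u] get the kinds 0 to 3. A larger degree forces a larger
   kind, and a larger kind a larger sum. *)
pose kind x := if x == u then 3 else if x == v then 2 else #|chd u par x|.
have kindP x : [\/ [/\ x = u, kind x = 3, deg e x = #|chd u par u| &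
      vsum e f x = SU],
    [/\ x = v, kind x = 2, deg e x = #|chd u par v|.+1 &
      vsum e f x = SV],
    [/\ x != u, x != v & exists z, [/\ kind x = 1, deg e x = 2, chd u par x z &
      vsum e f x = lab x + lab z]] |
    [/\ [/\ x != u, x != v & forall y, ~~ chd u par x y], kind x = 0, deg e x = 1 &
      vsum e f x = lab x]].
  rewrite /kind vsE degE; have [->|xu] := eqVneq x u; first exact: Or41.
  have [->|xv] := eqVneq x v; first by apply: Or42; rewrite add1n.
  have : #|chd u par x| <= 1.
    by have := hub x; rewrite (negbTE xu) (negbTE xv) degE xu add1n ltnS ltnNge => /negbFE.
  case E: #|chd u par x| => [|[|//]] _.
    apply: Or44; have no := childless x E; split => //.
    by rewrite big_pred0 ?addn0 // => y; apply: negbTE.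
  by have [|z xz sE] := child x xu xv; rewrite ?E //; apply: Or43; split=> //; exists z; rewrite sE.
have range x : [|| [&& kind x == 0, deg e x == 1 & vsum e f x <= M],
    [&& kind x == 1, deg e x == 2 & M < vsum e f x < SV],
    [&& kind x == 2, deg e x == #|chd u par v|.+1 & vsum e f x == SV] |
    [&& kind x == 3, deg e x == #|chd u par u| & vsum e f x == SU]].
  case: (kindP x) => [[_ -> -> ->]|[_ -> -> ->]|[xu xv [z [-> -> xz ->]]]|[[xu xv no] -> -> ->]].
  - by rewrite !eqxx !orbT.
  - by rewrite !eqxx !orbT.
  - by rewrite innerB.
  - by rewrite leafM.
have mono x y : kind x < kind y -> vsum e f x < vsum e f y.
  by move: (range x) (range y) MV VU; clear; lia.
split; last split.
- split=> [A B|A] /(edgesP eE)[x xu ->]; last first.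
    rewrite fE //; have := labB x xu.
    by rewrite -card_e addn1 ltnS.
  by move=> /(edgesP eE)[y yu ->]; rewrite !fE // => /labI->.
- move=> x y xy; have [kxy|kxy|kxy] := ltngtP (kind x) (kind y).
  + by rewrite ltn_eqF ?mono.
  + by rewrite gtn_eqF ?mono.
  apply: contra_neq xy => sxy; move: kxy sxy.
  case: (kindP x) => [[-> -> _ _]|[-> -> _ _]|[xu xv [z [-> _ xz ->]]]|[[xu xv _] -> _ ->]];
  case: (kindP y) => [[-> -> _ _]|[-> -> _ _]|[yu yv [w [-> _ yw ->]]]|[[yu yv _] -> _ ->]] // _.
  + exact: innerI.
  + exact: labI.
move=> x y dxy; apply: mono; move: (range x) (range y) card_uv dxy; clear; lia.
Qed.
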